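(* Let $D\in\{7,11,19,43,67,163\}$, let $r$ be a non-zero integer with $D\nmid r$, let $g$ be a non-zero integer, and let $E/\mathbb{Q}$ be the elliptic curve $E_{D,g}$ of the context (with CM by $\mathbb{Q}(\sqrt{-D})$). Then $\varpi_{E,r}$ vanishes if and only if one of the following 9 conditions holds: - $r\equiv2\ (\mathrm{mod}\ 4)$, $(-1)^{\frac{g_1+1}{2}}=(\frac{2g_1r}{D})$, $2\mid\lambda$, $\mathfrak{A}_2(g_1)\mid r$; - $r\equiv0\ (\mathrm{mod}\ 4)$, $(-1)^{\delta+\mu}=-(\frac{2g_1r}{D})$, $2\mid\lambda$, $\mathfrak{A}_2(g_1)\mid r$; - $r\equiv0\ (\mathrm{mod}\ 4)$, $(-1)^{\delta+\mu+\frac r4}=-(\frac{g_1r}{D})$, $2\nmid\lambda$, $\mathfrak{A}_2(g_1)\mid r$; - $2\nmid r$, $(-1)^{\frac{g_1+1}{2}}=(\frac{2g_1r}{D})$, $2$ divides both $\lambda$ and $\delta+\mu+\frac{g_1-1}{2}$, $\mathfrak{A}_2(g_1)\mid r$; - $r\equiv2\ (\mathrm{mod}\ 4)$, $(-1)^{\frac{g_1-1}{2}}=(\frac{2g_1r}{D})$, $2\mid\lambda$, $2\in\mathcal{J}_3(g,r)$, $D=11$; - $r\equiv0\ (\mathrm{mod}\ 4)$, $(-1)^{\delta+\mu}=(\frac{2g_1r}{D})$, $2\mid\lambda$, $2\in\mathcal{J}_3(g,r)$, $D=11$; - $r\equiv0\ (\mathrm{mod}\ 4)$, $(-1)^{\delta+\mu+\frac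 r4}=(\frac{g_1r}{D})$, $2\nmid\lambda$, $2\in\mathcal{J}_3(g,r)$, $D=11$; - $2\nmid r$, $(-1)^{\frac{g_1-1}{2}}=(\frac{2g_1r}{D})$, $2$ divides both $\lambda$ and $\delta+\mu+\frac{g_1-1}{2}$, $2\in\mathcal{J}_3(g,r)$, $D=11$; - $2\nmid r$, $D=7$.
   Context: Curves: $E_{7,g}:y^2=4x^3-\frac{35}{4}g^2x-\frac{49}{8}g^3$; $E_{11,g}:y^2=4x^3-\frac{88}{3}g^2x+\frac{847}{27}g^3$; $E_{19,g}:y^2=4x^3-152g^2x+361g^3$; $E_{43,g}:y^2=4x^3-80\cdot43g^2x+21\cdot43^2g^3$; $E_{67,g}:y^2=4x^3-440\cdot67g^2x+217\cdot67^2g^3$; $E_{163,g}:y^2=4x^3-53360\cdot163g^2x+185801\cdot163^2g^3$. Write $g=(-1)^\delta2^\lambda D^\mu g_1$ with $\delta\in\{0,1\}$, integers $\lambda,\mu\geqslant0$, $g_1\geqslant1$, $\gcd(g_1,2D)=1$. $\mathfrak{A}_j(q)=\prod_{p^\nu\parallel q,\ j\nmid\nu}p$; $\mathcal{J}_p(g,r)=\{j\in\mathbb{Z}_{\geqslant1}: j\nmid\mathrm{ord}_p(g_1),\ p\nmid r,\ \mathfrak{A}_j(g_1)\mid pr\}$ ($\mathrm{ord}_p$ the $p$-adic valuation). For $D\nmid r$, $\varpi_{E,r}=\frac{h_{D,r}}{2}\big(1+\varepsilon_D(g,r)(\frac{2^{\lambda+1}g_1r}{D})\Omega_2(D;g_1,r)\big)$,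 where $\Omega_2(D;g_1,r)=\prod_{p^\nu\parallel g_1,\ p\nmid r,\ 2\nmid\nu}\frac{-1}{p-1-(\frac{-D}{p})}$ (empty product $=1$) and $\varepsilon_D(g,r)=\frac12(-1)^{\frac{g_1-1}{2}}(1+(-1)^\lambda)$ for $r\equiv2$ mod $4$, $(-1)^{\delta+\mu+\frac{\lambda r}{4}}$ for $4\mid r$, $\frac14(1+(-1)^\lambda)((-1)^{\frac{g_1-1}{2}}+(-1)^{\delta+\mu})$ for $2\nmid r$. Here $h_{D,r}=\xi\frac{\sqrt D}{\varphi(D)}\prod_{p\nmid2r}\big(1-\frac{(\frac{-D}{p})}{p-1}\big)$ with (for $D\nmid r$) $\xi=1$ if $2\mid r$; $\xi=2$ if $2\nmid r$ and $D\equiv3$ mod $8$; $\xi=0$ if $2\nmid r$ and $D=7$. Products over primes in increasing order; $(\frac\cdot\cdot)$ is the Legendre symbol. *)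

(* Defs.v *)
From HB Require Import structures.
From mathcomp Require Import all_boot all_order all_algebra.
From mathcomp Require Import ring zify.
From mathcomp Require Import all_classical all_reals all_analysis.

Set Implicit Arguments.
Unset Strict Implicit.
Unset Printing Implicit Defensive.

Import Order.TTheory GRing.Theory Num.Theory.
Import numFieldNormedType.Exports.

Local Open Scope ring_scope.

(* The Legendre symbol (a / p), for an odd prime p. *)
Definition legendre (a : int) (p : nat) : int :=
  if (p %| a)%Z then 0
  else if [exists x : 'I_p, (p %| (x : nat)%:Z ^+ 2 - a)%Z] then 1 else -1.

(* The model y ^ 2 = 4 x ^ 3 + wa x + wb over Q. *)
Record weierstrass := Weierstrass { wa : rat; wb : rat }.

Definition on_curve (W : weierstrass) (x y : rat) : Prop :=
  y ^+ 2 = 4 * x ^+ 3 + wa W * x + wb W.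

(* Up to a nonzero constant, the discriminant of 4 x ^ 3 + wa x + wb. *)
Definition nonsingular (W : weierstrass) : bool :=
  wa W ^+ 3 + 27 * wb W ^+ 2 != 0.

(* The curve E_{D,g}, kept together with its parameters because lambda, mu,
   varpi, etc. attached to it are defined in terms of D and g. *)
Record cm_curve := CMCurve { cmD : nat; cmg : int }.

Definition cmDs : seq nat := [:: 7; 11; 19; 43; 67; 163]%N.

(* Coefficients of y ^ 2 = 4 x ^ 3 + a g ^ 2 x + b g ^ 3; the last value is
   irrelevant, D being in cmDs. *)
Definition cm_coefs (D : nat) : rat * rat :=
  if D == 7%N then (- (35 / 4), - (49 / 8))
  else if D == 11%N then (- (88 / 3), 847 / 27)
  else if D == 19%N then (- 152, 361)
  else if D == 43%N then (- (80 * 43), 21 * 43 ^+ 2)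
  else if D == 67%N then (- (440 * 67), 217 * 67 ^+ 2)
  else if D == 163%N then (- ((53 * 10 ^+ 3 + 360) * 163), (185 * 10 ^+ 3 + 801) * 163 ^+ 2)
  else (0, 0).

Definition cm_model (E : cm_curve) : weierstrass :=
  let g : rat := (cmg E)%:~R in
  Weierstrass ((cm_coefs (cmD E)).1 * g ^+ 2) ((cm_coefs (cmD E)).2 * g ^+ 3).

Coercion cm_model : cm_curve >-> weierstrass.

Lemma cm_coefs_disc (D : nat) : D \in cmDs ->
  (cm_coefs D).1 ^+ 3 + 27 * (cm_coefs D).2 ^+ 2 = D%:R ^+ 3.
Proof.
by rewrite !inE; do 5?[case/orP]; move=> /eqP->; rewrite /cm_coefs /=; field.
Qed.

Lemma cm_nonsingular (D : nat) (g : int) :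
  D \in cmDs -> g != 0 -> nonsingular (CMCurve D g).
Proof.
move=> hD g0; rewrite /nonsingular /=.
have := cm_coefs_disc hD; case: (cm_coefs D) => a b /= disc.
have -> : (a * g%:~R ^+ 2) ^+ 3 + 27 * (b * g%:~R ^+ 3) ^+ 2
          = (a ^+ 3 + 27 * b ^+ 2) * g%:~R ^+ 6 by ring.
rewrite disc mulf_neq0 ?expf_neq0 ?intr_eq0 // pnatr_eq0.
by move: hD; rewrite !inE; do 5?[case/orP]; move=> /eqP->.
Qed.

Section Decomposition.

Variable E : cm_curve.

(* g = (-1) ^ delta * 2 ^ lambda * D ^ mu * g1 with gcd(g1, 2 D) = 1
   (see cm_decomposition below). *)
Definition cm_delta : nat := (cmg E < 0)%R.
Definition cm_lambda : nat := logn 2 `|cmg E|%N.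
Definition cm_mu : nat := logn (cmD E) `|cmg E|%N.
Definition cm_g1 : nat := (`|cmg E| %/ (2 ^ cm_lambda * cmD E ^ cm_mu))%N.

End Decomposition.

Lemma cm_decomposition (D : nat) (g : int) (E := CMCurve D g) :
  D \in cmDs -> g != 0 ->
  [/\ g = (-1) ^+ cm_delta E * 2 ^+ cm_lambda E * D%:Z ^+ cm_mu E
            * (cm_g1 E)%:Z,
      (0 < cm_g1 E)%N & coprime (cm_g1 E) (2 * D)].
Proof.
move=> hD g0.
have pD : prime D.
  by move: hD; rewrite !inE; do 5?[case/orP]; move=> /eqP->.
have D2 : D != 2%N.
  by move: hD; rewrite !inE; do 5?[case/orP]; move=> /eqP->.
have n0 : (0 < `|g|)%N by rewrite absz_gt0.
have cop : coprime (2 ^ cm_lambda E) (D ^ cm_mu E).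
  by rewrite coprimeXl ?coprimeXr // prime_coprime // dvdn_prime2 // eq_sym.
have dv : (2 ^ cm_lambda E * D ^ cm_mu E %| `|g|)%N.
  by rewrite Gauss_dvd // !pfactor_dvdnn.
have eqn : (`|g| = 2 ^ cm_lambda E * D ^ cm_mu E * cm_g1 E)%N.
  by rewrite mulnC divnK.
have g10 : (0 < cm_g1 E)%N.
  by move: n0; rewrite eqn; case: (cm_g1 E) => //; rewrite muln0.
have key p : prime p ->
    logn p (2 ^ cm_lambda E * D ^ cm_mu E) = logn p `|g|%N ->
    coprime (cm_g1 E) p.
  move=> pp; rewrite [in RHS]eqn [RHS]lognM //; last first.
    by rewrite muln_gt0 !expn_gt0 (prime_gt0 pD).
  move=> /eqP; rewrite -{1}[logn p _]addn0 eqn_add2l eq_sym => /eqP l0.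
  rewrite coprime_sym prime_coprime //; apply/negP => dp.
  by have := pfactor_dvdn 1 pp g10; rewrite l0 expn1 dp.
split=> //.
- rewrite [LHS]intEsign -!mulrA; congr (_ * _).
  have PX (a k : nat) : (a ^ k)%N%:Z = a%:Z ^+ k by rewrite -natz natrX natz.
  by rewrite eqn !PoszM !PX mulrA.
- have lgn p : prime p -> logn p (2 ^ cm_lambda E * D ^ cm_mu E)
      = (cm_lambda E * (p == 2) + cm_mu E * (p == D))%N.
    move=> pp; rewrite lognM ?expn_gt0 ?(prime_gt0 pD) // !lognX.
    by rewrite (logn_prime p (isT : prime 2)) (logn_prime p pD).
  rewrite coprimeMr !key // lgn // eqxx.
  + by rewrite (negbTE D2) muln0 muln1.
  + by rewrite eq_sym (negbTE D2) muln0 muln1 addn0.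
Qed.

(* A_j(q), with p ^ nu || q written as nu = logn p q. *)
Definition frakA (j q : nat) : nat :=
  (\prod_(p <- primes q | ~~ (j %| logn p q)) p)%N.

(* J_p(g, r), as a set of natural numbers. *)
Definition calJ (E : cm_curve) (p : nat) (r : int) : pred nat :=
  [pred j | [&& (1 <= j)%N, ~~ (j %| logn p (cm_g1 E))%N, ~~ (p %| r)%Z
            & (frakA j (cm_g1 E) %| p%:Z * r)%Z]].

Section Varpi.

Variable R : realType.

Definition Omega2 (D g1 : nat) (r : int) : R :=
  \prod_(p <- primes g1 | ~~ (p %| r)%Z && ~~ (2 %| logn p g1)%N)
    (-1 / (p%:R - 1 - (legendre (- D%:Z) p)%:~R)).

(* In the branch 4 | r the exponent is a possibly negative integer. *)
Definition epsilonD (E : cm_curve) (r : int) : R :=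
  let delta := cm_delta E in let lambda := cm_lambda E in
  let mu := cm_mu E in let g1 := cm_g1 E in
  if (r == 2 %[mod 4])%Z then
    2^-1 * (-1) ^+ (g1.-1)./2 * (1 + (-1) ^+ lambda)
  else if (4 %| r)%Z then
    (-1) ^ (delta%:Z + mu%:Z + ((lambda%:Z * r) %/ 4)%Z)
  else
    4^-1 * (1 + (-1) ^+ lambda) * ((-1) ^+ (g1.-1)./2 + (-1) ^+ (delta + mu)).

(* For D in cmDs and D not dividing r, the last case is D = 7. *)
Definition xi (D : nat) (r : int) : R :=
  if (2 %| r)%Z then 1 else if (D == 3 %[mod 8])%N then 2 else 0.

(* The infinite product over the primes p not dividing 2 r converges only
   conditionally: it is the limit of the products over p < n. *)
Definition hDr (D : nat) (r : int) : R :=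
  xi D r * (Num.sqrt D%:R / (totient D)%:R) *
  limn (fun n : nat =>
    \prod_(0 <= p < n | prime p && ~~ (p %| 2 * r)%Z)
      (1 - (legendre (- D%:Z) p)%:~R / (p%:R - 1)) : R).

Definition varpi (E : cm_curve) (r : int) : R :=
  let D := cmD E in let g1 := cm_g1 E in
  hDr D r / 2 *
  (1 + epsilonD E r
       * (legendre (2 ^+ (cm_lambda E).+1 * g1%:Z * r) D)%:~R
       * Omega2 D g1 r).

End Varpi.

(* Main.v *)
From Stdlib Require BinInt.
Require Import Defs.
From HB Require Import structures.
From mathcomp Require Import all_boot all_order all_fingroup all_algebra.
From mathcomp Require Import all_solvable all_field.
From mathcomp Require Import ring lra zify ssrZ.
From mathcomp Require Import all_classical all_reals all_analysis.

(* The factor h_{D,r} vanishes only through xi: its infinite product is nonzero.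
   By quadratic reciprocity (-D / p) = chi(p) with chi = (. / D), and log n =
   sum of log p over the prime powers p^k dividing n turns the bounded sum of
   chi(n) log n / n into L(1, chi) times the sum of chi(p) log p / p, up to
   errors controlled by Chebyshev's bound on theta.  Since L(1, chi) <> 0 (a
   finite computation for each D, the tail beyond 5 D terms being at most 1 / 5),
   the sum of chi(p) log p / p is bounded, so the sum of chi(p) / p converges
   and the product has a positive limit.
   The other factor vanishes iff epsilon times the Legendre symbol times Omega2
   is -1.  A factor of Omega2 has absolute value at most 1 / 3, except that it is
   -1 for p = 3, D = 11; hence Omega2 is 1 when it is an empty product, -1 when
   D = 11 and 3 is its only prime, and has absolute value < 1 otherwise. *)

Set Implicit Arguments.
Unset Strict Implicit.
Unset Printing Implicit Defensive.

Import Order.TTheory GRing.Theory Num.Theory.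
Import numFieldNormedType.Exports.

Local Open Scope ring_scope.

(** * The Legendre symbol *)

(** The nonzero elements have a generator [z], and [z ^ m = -1]. So [x = z ^ i] gives
    [x ^ m = (-1) ^ i], and an even [i] exhibits [x] as a square. *)
Lemma euler_criterion (F : finFieldType) (m : nat) (x : F) :
  #|F| = m.*2.+1 -> x != 0 ->
  x ^+ m = if [exists y : F, y ^+ 2 == x] then 1 else -1.
Proof.
move=> cardF x0.
have m0 : (0 < m)%N.
  by have := finNzRing_gt1 F; rewrite cardF; lia.
have unity (y : F) : y != 0 -> y ^+ m.*2 = 1.
  move=> y0; apply: (mulfI y0).
  by rewrite mulr1 -exprS -cardF expf_card.
have [z zprim] : exists z : F, m.*2.-primitive_root z.
  have: has m.*2.-primitive_root [seq y <- enum F | y != 0].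
    apply: has_prim_root; first lia.
    - apply/allP => y; rewrite mem_filter => /andP[y0 _].
      by apply/unity_rootP; exact: unity.
    - by rewrite filter_uniq // enum_uniq.
    - rewrite size_filter -(eq_count (a1 := predC1 0)) //.
      have := cardC1 (0 : F); rewrite cardF /= => <-.
      by rewrite cardE -size_filter enumT /enum_mem size_filter.
  by case/hasP => z _; exists z.
have zm : z ^+ m = -1.
  have : (z ^+ m == 1) || (z ^+ m == -1).
    by rewrite -eqf_sqr expr1n -exprM muln2 (prim_expr_order zprim).
  by rewrite -(prim_order_dvd zprim) gtnNdvd //=; [move/eqP|lia].
have neg1 : -1 != 1 :> F.
  by rewrite -zm -(prim_order_dvd zprim) gtnNdvd //; lia.
have [i _ xi] : exists2 i, true & x = z ^+ i.
  have [[i] /= _ xi] := prim_rootP zprim (unity x x0); by exists i.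
have xm : x ^+ m = (-1) ^+ i by rewrite xi exprAC zm.
rewrite xm; case: existsP => [[y /eqP yx]|nosq].
  rewrite -xm -yx -exprM mulnC muln2 unity //.
  by apply: contra_neq x0 => y0; rewrite -yx y0 expr0n.
rewrite -signr_odd; case oi: (odd i); first by rewrite expr1.
case: nosq; exists (z ^+ i./2).
by rewrite -exprM muln2 xi; apply/eqP; congr (_ ^+ _); lia.
Qed.

Lemma legendre_sqr (a : int) (p : nat) : prime p ->
  [exists x : 'I_p, (p %| (x : nat)%:Z ^+ 2 - a)%Z]
    = [exists y : 'F_p, y ^+ 2 == a%:~R].
Proof.
move=> pp; have chp := pchar_Fp pp.
have dvdE (x : nat) : (p %| x%:Z ^+ 2 - a)%Z = (x%:R ^+ 2 == a%:~R :> 'F_p).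
  by rewrite (dvdz_pcharf chp) rmorphB rmorphXn /= subr_eq0.
apply/existsP/existsP => [[x]|[y]].
  by rewrite dvdE => xa; exists (x : nat)%:R.
have ylt : (y < p)%N by rewrite -[X in (_ < X)%N](Fp_cast pp) ltn_ord.
by move=> ya; exists (Ordinal ylt); rewrite dvdE /= natr_Zp.
Qed.

(** The identity is a congruence of integers modulo [p], so Euler's criterion in ['F_p] gives it in
    every ring of characteristic [p]. Reciprocity uses it in an extension of ['F_p]. *)
Lemma legendreE (K : nzRingType) (a : int) (p : nat) : odd p -> p \in [pchar K] ->
  (legendre a p)%:~R = a%:~R ^+ p./2 :> K.
Proof.
move=> op chK; have pp := pcharf_prime chK.
apply/eqP; rewrite -subr_eq0 -rmorphXn -rmorphB -(dvdz_pcharf chK) /=.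
rewrite (dvdz_pcharf (pchar_Fp pp)) rmorphB rmorphXn subr_eq0 /=; apply/eqP.
rewrite /legendre (dvdz_pcharf (pchar_Fp pp)).
have p2 : (0 < p./2)%N by have := prime_gt1 pp; case: p op {pp chK} => [|[|[|]]].
case: eqP => [->|/eqP a0]; first by rewrite expr0n eqn0Ngt p2.
rewrite (@euler_criterion _ p./2 _ _ a0) ?card_Fp //; last by lia.
by rewrite legendre_sqr //; case: ifP.
Qed.

Variant legendre_spec (a : int) (p : nat) : int -> Prop :=
| LegendreDvd of (p %| a)%Z : legendre_spec a p 0
| LegendrePos of ~~ (p %| a)%Z : legendre_spec a p 1
| LegendreNeg of ~~ (p %| a)%Z : legendre_spec a p (-1).

Lemma legendreP (a : int) (p : nat) : legendre_spec a p (legendre a p).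
Proof.
by rewrite /legendre; case: ifPn => [|na]; [|case: ifP]; constructor.
Qed.

(** The values 0, 1, -1 stay distinct modulo an odd prime, so equalities of symbols may be proved in
    characteristic [p], even for symbols with different moduli. *)
Lemma legendre_inj (K : nzRingType) (a b : int) (p q r : nat) (x y : int) :
  odd p -> p \in [pchar K] ->
  legendre_spec a q x -> legendre_spec b r y -> x%:~R = y%:~R :> K -> x = y.
Proof.
move=> op chK xP yP /eqP.
have p3 : (2 < p)%N.
  by have := prime_gt1 (pcharf_prime chK); case: p op {chK} => [|[|[|]]].
rewrite -subr_eq0 -rmorphB -(dvdz_pcharf chK).
by case: xP => _; case: yP => _ //; rewrite dvdzE /= gtnNdvd //; lia.
Qed.

Lemma legendreM (p : nat) : prime p -> odd p ->
  {morph legendre^~ p : a b / a * b}.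
Proof.
move=> pp op a b; have chp := pchar_Fp pp.
have abP : legendre_spec (a * b) p (legendre a p * legendre b p).
  have ab : (p %| a * b)%Z = (p %| a)%Z || (p %| b)%Z.
    by rewrite !dvdzE abszM Euclid_dvdM.
  case: (legendreP a p) => ha; case: (legendreP b p) => hb;
    rewrite ?mul0r ?mulr0 ?mulr1 ?mulN1r ?opprK;
    by constructor; rewrite ab ?ha ?hb ?orbT ?negb_or ?ha ?hb.
apply: (legendre_inj op chp (legendreP _ _) abP).
by rewrite rmorphM /= !(legendreE _ op chp) rmorphM /= exprMn.
Qed.

Lemma legendre_intr (a b : int) (p : nat) : prime p -> odd p ->
  a%:~R = b%:~R :> 'F_p -> legendre a p = legendre b p.
Proof.
move=> pp op ab; have chp := pchar_Fp pp.
by apply: (legendre_inj op chp (legendreP _ _) (legendreP _ _));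
  rewrite !(legendreE _ op chp) ab.
Qed.

Lemma legendre1 (p : nat) : prime p -> odd p -> legendre 1 p = 1.
Proof.
move=> pp op; have chp := pchar_Fp pp.
have oneP : legendre_spec 1 p 1.
  by constructor; rewrite dvdzE /= gtnNdvd // prime_gt1.
apply: (legendre_inj op chp (legendreP _ _) oneP).
by rewrite (legendreE _ op chp) expr1n.
Qed.

Lemma legendreN1 (p : nat) : prime p -> (p %% 4 = 3)%N -> legendre (-1) p = -1.
Proof.
move=> pp p4; have chp := pchar_Fp pp.
have op : odd p by lia.
have negP : legendre_spec (-1) p (-1).
  by constructor; rewrite dvdzE /= gtnNdvd // prime_gt1.
apply: (legendre_inj op chp (legendreP _ _) negP).
rewrite (legendreE _ op chp) rmorphN1 -signr_odd.
have -> : odd p./2 by lia.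
by rewrite expr1.
Qed.

(** In the field with [p ^ (q - 1)] elements, Fermat's theorem makes [q] divide the order of the
    unit group, and Cauchy's theorem gives an element of order [q]. *)
Lemma primitive_root_pchar (p q : nat) : prime p -> prime q -> p != q ->
  exists (K : fieldType) (z : K), p \in [pchar K] /\ q.-primitive_root z.
Proof.
move=> pp pq neq.
have q1 : (0 < q.-1)%N by have := prime_gt1 pq; lia.
have [K chK cardK] := PrimePowerField pp q1.
have qdvd : (q %| #|[set: {unit K}]|)%N.
  rewrite card_finField_unit cardK.
  have cop : coprime p q by rewrite prime_coprime // dvdn_prime2.
  rewrite -subn1 -eqn_mod_dvd ?expn_gt0 ?prime_gt0 //.
  by rewrite -totient_prime //; apply/eqP/Euler_exp_totient.
have [x _ ox] := Cauchy pq qdvd.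
exists K, (val x); split=> //.
have x1 : (val x) ^+ q = 1 by rewrite -FinRing.val_unitX -ox expg_order.
have [m mprim mq] := prim_order_exists (prime_gt0 pq) x1.
suff <- : m = q by [].
apply/prime_nt_dvdP => //; apply/eqP => m1.
move: (prim_expr_order mprim); rewrite m1 expr1 => zone.
have xone : x = 1%g by apply: val_inj.
by have := prime_gt1 pq; rewrite -ox xone order1.
Qed.

(* For the Gauss sum tau in characteristic p, tau ^ 2 = - q while Frobenius gives
   tau ^ p = chi p * tau; Euler's criterion compares the two. *)
Lemma legendre_reciprocity (p q : nat) : prime p -> odd p -> prime q ->
  (q %% 4 = 3)%N -> legendre (- q%:Z) p = legendre p%:Z q.
Proof.
move=> pp op pq q4; have oq : odd q by lia.
have [<-|neq] := eqVneq p q.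
  rewrite /legendre ifT ?ifT // dvdzE //= abszN.
  by rewrite dvdnn.
have [K [z [chK zprim]]] := primitive_root_pchar pp pq neq.
pose chi (a : 'F_q) : K := (legendre (a : nat)%:Z q)%:~R.
pose e (a : 'F_q) : K := z ^+ (a : nat).
have chiE (a : 'F_q) (k : int) : a = k%:~R -> chi a = (legendre k q)%:~R.
  move=> ak; congr (_%:~R); apply: legendre_intr => //.
  by rewrite -ak -[RHS]natr_Zp.
have intF (a : 'F_q) : a = (a : nat)%:Z%:~R by rewrite -[LHS]natr_Zp.
have chiM a b : chi (a * b) = chi a * chi b.
  rewrite (chiE _ ((a : nat)%:Z * (b : nat)%:Z)); first by rewrite legendreM // rmorphM.
  by rewrite rmorphM /= -!intF.
have chiN1 : chi (-1) = -1 by rewrite (chiE _ (-1)) // legendreN1.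
have chi_sqr a : chi a * chi a = (a != 0)%:R.
  rewrite /chi [in RHS](intF a) -(dvdz_pcharf (pchar_Fp pq)).
  by case: legendreP => [->|/negPf->|/negPf->]; rewrite ?mulr0 ?mulr1 ?mulrNN ?mulr1.
have eD a b : e (a + b) = e a * e b.
  rewrite /e -exprD -{1}(natr_Zp a) -{1}(natr_Zp b) -natrD val_Fp_nat //.
  by rewrite (prim_expr_mod zprim).
(* Replacing [a] by [- a] changes the sign of the sum, and 2 is invertible because [p] is odd. *)
have chi_sum : \sum_a chi a = 0.
  have : (1 + 1) * \sum_a chi a = 0.
    rewrite mulrDl !mul1r {1}(reindex_inj oppr_inj) /=.
    rewrite -big_split big1 //= => a _.
    by rewrite -mulN1r chiM chiN1 mulN1r addNr.
  move/eqP; rewrite mulf_eq0 => /orP[|/eqP //].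
  rewrite -(natrD _ 1 1) -(dvdn_pcharf chK) => /dvdn_leq; have := prime_gt1 pp; lia.
(* Orthogonality: the shift of [a] by 1 multiplies the sum by [e c], which is not 1 when [c] is
   nonzero. *)
have e_sum c : \sum_a e (a * c) = if c == 0 then q%:R else 0.
  case: eqP => [->|/eqP c0].
    under eq_bigr do rewrite mulr0 /e expr0.
    by rewrite sumr_const card_Fp.
  have ec : e c - 1 != 0.
    rewrite subr_eq0 /e -(prim_order_dvd zprim) -[(q %| _)%N]/(q %| (c : nat)%:Z)%Z.
    by rewrite (dvdz_pcharf (pchar_Fp pq)) -intF.
  apply: (mulIf ec); rewrite mul0r mulrBr mulr1; apply/eqP.
  rewrite subr_eq0 [eqbRHS](reindex_inj (addIr 1)) mulr_suml; apply/eqP.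
  by apply: eq_bigr => a _; rewrite mulrDl mul1r eD.
pose tau := \sum_a chi a * e a.
have tau2 : tau ^+ 2 = - q%:R.
  rewrite expr2 {1}/tau mulr_suml.
  (* The second index is written as [a * c], so that [chi a * chi (a * c)] collapses to [chi c] for
     nonzero [a]. *)
  transitivity (\sum_c chi c * \sum_a (a != 0)%:R * e (a * (1 + c))).
    under [RHS]eq_bigr do rewrite mulr_sumr.
    rewrite [RHS]exchange_big; apply: eq_bigr => a _ /=.
    have [->|a0] := eqVneq a 0.
      rewrite (chiE 0 0) // {1}/legendre dvdz0 !mul0r big1 // => b _.
      by rewrite mulr0.
    rewrite mulr_sumr (reindex_inj (mulfI a0)) /=; apply: eq_bigr => b _.
    rewrite /= mulrDr mulr1 eD chiM.
    transitivity (chi a * chi a * (chi b * (e a * e (a * b)))); first by ring.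
    by rewrite chi_sqr a0 !mul1r.
  have inner c : \sum_a (a != 0)%:R * e (a * (1 + c)) = \sum_a e (a * (1 + c)) - 1.
    rewrite (bigD1 0) //= [in RHS](bigD1 0) //= ?eqxx !mul0r add0r.
    rewrite (_ : e 0 = 1); last by rewrite /e expr0.
    by rewrite addrAC subrr add0r; apply: eq_bigr => a ->; rewrite mul1r.
  (* Only [c = -1] survives, with weight [q * chi (-1) = - q]; the terms [- chi c] sum to 0. *)
  under eq_bigr do rewrite inner e_sum mulrBr mulr1.
  rewrite sumrB chi_sum subr0 (bigD1 (-1)) //= subrr eqxx chiN1 mulN1r.
  rewrite big1 ?addr0 // => c; rewrite addrC addr_eq0 => /negPf->.
  by rewrite mulr0.
have tau0 : tau != 0.
  have : tau ^+ 2 != 0 by rewrite tau2 oppr_eq0 -(dvdn_pcharf chK) dvdn_prime2.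
  by rewrite expf_eq0.
have chiX a : chi a ^+ p = chi a.
  rewrite /chi; case: legendreP => _.
  - by rewrite expr0n gtn_eqF ?prime_gt0.
  - by rewrite expr1n.
  - by rewrite rmorphN1 -signr_odd op expr1.
have tauX : tau ^+ p = chi p%:R * tau.
  rewrite -(pFrobenius_autE chK) raddf_sum /= mulr_sumr.
  have p0 : p%:R != 0 :> 'F_q.
    by rewrite -(dvdn_pcharf (pchar_Fp pq)) dvdn_prime2 // eq_sym.
  rewrite [RHS](reindex_inj (mulfI p0)) /=; apply: eq_bigr => a _.
  rewrite pFrobenius_autE exprMn chiX mulrA chiM mulrA chi_sqr p0 mul1r.
  congr (_ * _); rewrite /e -exprM -(prim_expr_mod zprim); congr (_ ^+ _).
  by rewrite -{2}(natr_Zp a) -natrM val_Fp_nat // mulnC.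
apply: (legendre_inj op chK (legendreP _ _) (legendreP _ _)).
apply: (mulIf tau0); rewrite (legendreE _ op chK).
rewrite -(chiE p%:R) // -tauX rmorphN -tau2 -exprM -exprSr.
by congr (_ ^+ _); lia.
Qed.

(** * Partial summation and Chebyshev's bound *)

Local Open Scope classical_set_scope.
Local Open Scope ring_scope.

(** Abel summation: without the boundary term [A * u n], [A] being the full sum of the [a i], the
    sum is at most [B * (u m - u n)]; the boundary term adds at most [B * u n]. *)
Lemma norm_sum_antitone_le (R : realDomainType) (a u : nat -> R) (B : R)
    (m n : nat) : (m <= n)%N ->
  (forall k l, `|\sum_(k <= i < l) a i| <= B) ->
  (forall i, (m <= i)%N -> 0 <= u i.+1 <= u i) -> 0 <= u m ->
  `|\sum_(m <= i < n) a i * u i| <= B * u m.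
Proof.
move=> mn aB u_anti um.
have u_ge0 i : (m <= i)%N -> 0 <= u i.
  case: i => [|i]; first by rewrite leqn0 => /eqP<-.
  by rewrite leq_eqVlt ltnS => /orP[/eqP<-//|/u_anti/andP[]].
have key : `|\sum_(m <= i < n) a i * u i - (\sum_(m <= i < n) a i) * u n|
    <= B * (u m - u n).
  elim: n mn => [|n IH].
    by rewrite leqn0 => /eqP->; rewrite !big_geq // mul0r !subrr normr0 mulr0.
  rewrite leq_eqVlt => /orP[/eqP<-|].
    by rewrite !big_geq // mul0r !subrr normr0 mulr0.
  rewrite ltnS => mn; rewrite !big_nat_recr //=.
  set S := \sum_(_ <= _ < _) _; set A := \sum_(_ <= _ < _) _.
  have -> : S + a n * u n - (A + a n) * u n.+1
      = (S - A * u n) + (A + a n) * (u n - u n.+1) by ring.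
  rewrite (le_trans (ler_normD _ _)) //.
  have -> : B * (u m - u n.+1) = B * (u m - u n) + B * (u n - u n.+1) by ring.
  rewrite lerD ?IH // normrM [X in _ * X]ger0_norm; last first.
    by rewrite subr_ge0; have /andP[] := u_anti _ mn.
  rewrite ler_wpM2r //; first by rewrite subr_ge0; have /andP[] := u_anti _ mn.
  by have := aB m n.+1; rewrite big_nat_recr.
rewrite -[X in `|X|](subrK ((\sum_(m <= i < n) a i) * u n)).
rewrite (le_trans (ler_normD _ _)) //.
have -> : B * u m = B * (u m - u n) + B * u n by ring.
by rewrite lerD // normrM (ger0_norm (u_ge0 _ mn)) ler_wpM2r // u_ge0.
Qed.

(** The block bound of Abel summation gives the Cauchy criterion. It also gives the explicit
    remainder, needed later to compare partial sums with L(1, chi). *)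
Lemma dirichlet_test (R : realType) (a u : nat -> R) (B : R) (m : nat) :
  (forall k l, `|\sum_(k <= i < l) a i| <= B) ->
  (forall i, (m <= i)%N -> 0 <= u i.+1 <= u i) -> 0 <= u m ->
  u @ \oo --> 0 ->
  exists2 L : R, series (fun i => a i * u i) @ \oo --> L &
    forall n, (m <= n)%N -> `|\sum_(0 <= i < n) a i * u i - L| <= B * u n.
Proof.
move=> aB u_anti um u0.
have B0 : 0 <= B by apply: le_trans (aB 0%N 0%N).
have u_ge0 i : (m <= i)%N -> 0 <= u i.
  case: i => [|i]; first by rewrite leqn0 => /eqP<-.
  by rewrite leq_eqVlt ltnS => /orP[/eqP<-//|/u_anti/andP[]].
have tail n k : (m <= n)%N -> (n <= k)%N ->
    `|\sum_(n <= i < k) a i * u i| <= B * u n.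
  move=> mn nk; apply: norm_sum_antitone_le => // [i ni|]; last exact: u_ge0.
  by apply: u_anti; apply: leq_trans ni.
have cv : cvgn (series (fun i => a i * u i)).
  apply/cauchy_cvgP/cauchy_seriesP => e e0.
  (* Dividing by [B + 1] covers the case [B = 0]. *)
  have d0 : 0 < e / (B + 1) by rewrite divr_gt0 // ltr_wpDl.
  have /cvgrPdist_lt/(_ _ d0)[N _ Nu] := u0.
  exists ([set n | (maxn N m <= n)%N], setT).
    by split => //=; [exists (maxn N m)|exists 0%N].
  case=> n k /= [mn _].
  have [kn|/ltnW nk] := leqP k n; first by rewrite big_geq ?normr0.
  move: mn; rewrite geq_max => /andP[Nn mn].
  apply: le_lt_trans (tail _ _ mn nk) _.
  have := Nu n Nn; rewrite /= sub0r normrN ger0_norm ?u_ge0 // => un.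
  apply: le_lt_trans (_ : B * (e / (B + 1)) < _).
    by rewrite ler_wpM2l // ltW.
  by rewrite mulrCA -[ltRHS]mulr1 ltr_pM2l // ltr_pdivrMr ?mul1r ?ltrDl // ltr_wpDl.
exists (limn (series (fun i => a i * u i))) => // n mn.
have cvn : (fun k => `|\sum_(0 <= i < n) a i * u i
    - series (fun i => a i * u i) k|) @ \oo -->
    `|\sum_(0 <= i < n) a i * u i - limn (series (fun i => a i * u i))|.
  by apply: cvg_norm; apply: cvgB => //; exact: cvg_cst.
apply: cvgr_to_le cvn _.
exists n => // k /= nk; rewrite /series /= distrC.
rewrite (big_cat_nat (leq0n n) nk) /= addrAC subrr add0r.
exact: tail.
Qed.

(** Distinct primes are coprime. This serves both the primorial bound and, later, divisibility by
    [frakA]. *)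
Lemma prod_primes_dvd (s : seq nat) (N : nat) :
  uniq s -> all prime s -> (\prod_(p <- s) p %| N)%N = all (fun p => p %| N)%N s.
Proof.
elim: s => [|p s IH] /=; first by rewrite big_nil dvd1n.
case/andP=> ps us /andP[pp alls]; rewrite big_cons Gauss_dvd ?IH //.
rewrite prime_coprime // Euclid_dvd_prod // big_has; apply/hasPn => q qs.
rewrite dvdn_prime2 //; last by apply: (allP alls).
by apply: contra ps => /eqP->.
Qed.

Lemma bin_le_exp2 (n k : nat) : ('C(n.+1, k) <= 2 ^ n)%N.
Proof.
elim: n k => [|n IH] [|k]; rewrite ?bin0 ?expn_gt0 //; first by case: k => [|[]].
by rewrite binS expnS mul2n -addnn leq_add.
Qed.

(** Erdős's induction: an even number above 2 adds no prime. For [2 m + 1], the primes up to [m + 1]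
    contribute at most [4 ^ (m + 1)], and the others divide a binomial coefficient that is at most
    [4 ^ m]. *)
Lemma prod_primes_le (n : nat) : (\prod_(0 <= p < n.+1 | prime p) p <= 4 ^ n)%N.
Proof.
elim/ltn_ind: n => -[|[|[|n]]] IH;
  [by rewrite unlock | by rewrite unlock | by rewrite unlock |].
have [ev|od] := boolP (odd n).
  have np : prime n.+3 = false.
    by apply/negP => /even_prime[//|]; rewrite /= ev.
  rewrite big_mkcond big_nat_recr //= np muln1 -big_mkcond.
  by rewrite (leq_trans (IH n.+2 _)) // leq_exp2l.
have [m nm] : exists m, n.+3 = m.*2.+1.
  by exists (n.+2)./2; lia.
rewrite nm; have m0 : (0 < m)%N by lia.
rewrite (big_cat_nat (n := m.+2)) //=; last lia.
(* Such a prime divides [(2 m + 1)!] but neither [m!] nor [(m + 1)!]. *)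
have dv : (\prod_(m.+2 <= p < m.*2.+2 | prime p) p %| 'C(m.*2.+1, m))%N.
  rewrite -big_filter prod_primes_dvd ?filter_uniq ?iota_uniq ?filter_all //.
  apply/allP => p; rewrite mem_filter mem_index_iota => /and3P[pp mp pm].
  have pN k : (k < p)%N -> ~~ (p %| k`!)%N.
    elim: k => [|k IHk] kp; first by rewrite fact0 dvdn1 gtn_eqF // prime_gt1.
    by rewrite factS Euclid_dvdM // negb_or gtnNdvd // IHk // ltnW.
  have : (p %| (m.*2.+1)`!)%N by rewrite dvdn_fact // prime_gt0.
  have mm : (m <= m.*2.+1)%N by lia.
  rewrite -(bin_fact mm) Euclid_dvdM // => /orP[//|].
  rewrite Euclid_dvdM // (negPf (pN _ _)) ?(negPf (pN _ _)) //; lia.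
(* The two equal middle coefficients add up to ['C(2 m + 2, m + 1)], which is at most
   [2 ^ (2 m + 1)]. *)
have Cle : ('C(m.*2.+1, m) <= 4 ^ m)%N.
  have C2 : ('C(m.*2.+1, m) + 'C(m.*2.+1, m.+1) <= 2 ^ m.*2.+1)%N.
    by rewrite addnC -binS bin_le_exp2.
  have := bin_sub (_ : (m <= m.*2.+1)%N); rewrite (_ : m.*2.+1 - m = m.+1)%N; last lia.
  move=> Ce; move: C2; rewrite Ce; last lia.
  by rewrite addnn expnS mul2n leq_double -mul2n expnM.
have -> : (4 ^ m.*2.+1 = 4 ^ m.+1 * 4 ^ m)%N by rewrite -expnD; congr (_ ^ _)%N; lia.
apply: leq_mul; first by apply: IH; lia.
apply: leq_trans Cle; apply: dvdn_leq dv; rewrite bin_gt0; lia.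
Qed.

Lemma ln_prod (R : realType) (I : Type) (r : seq I) (P : pred I) (F : I -> R) :
  (forall i, P i -> 0 < F i) ->
  ln (\prod_(i <- r | P i) F i) = \sum_(i <- r | P i) ln (F i).
Proof.
move=> F0; pose K (x y : R) := 0 < x /\ ln x = y.
suff [] : K (\prod_(i <- r | P i) F i) (\sum_(i <- r | P i) ln (F i)) by [].
apply: big_rec2 => [|i y x Pi [x0 <-]]; first by split; rewrite ?ltr01 ?ln1.
by split; rewrite ?mulr_gt0 ?F0 // lnM ?posrE ?F0.
Qed.

Definition theta (R : realType) (n : nat) : R :=
  \sum_(0 <= p < n.+1 | prime p) ln p%:R.

Lemma theta_le (R : realType) (n : nat) : theta R n <= n%:R * ln 4.
Proof.
rewrite /theta -ln_prod => [|p pp]; last by rewrite ltr0n prime_gt0.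
rewrite -natr_prod [leRHS]mulr_natl -lnXn // -natrX.
rewrite ler_ln ?posrE ?ltr0n ?expn_gt0 ?ler_nat ?prod_primes_le //.
by rewrite prodn_cond_gt0 // => p /prime_gt0.
Qed.

(** * Character sums over primes *)

(** This is log n as the divisor sum of the von Mangoldt function. The common range up to [N],
    independent of [n], allows the sums to be exchanged later. *)
Lemma ln_nat_sum_primes (R : realType) (N n : nat) : (0 < n <= N)%N ->
  ln n%:R = \sum_(0 <= p < N.+1 | prime p) \sum_(1 <= k < N.+1)
              (p ^ k %| n)%:R * ln p%:R :> R.
Proof.
case/andP=> n0 nN; rewrite -[in LHS](partnT n0) (widen_partn _ nN).
rewrite natr_prod ln_prod => [|p _]; last by rewrite ltr0n pfactor_gt0.
rewrite [RHS]big_mkcond /=; apply: eq_bigr => p _; case: ifPn => [pp|np]; last first.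
  by rewrite lognE (negPf np) expn0 ln1.
rewrite natrX lnXn ?ltr0n ?prime_gt0 // -mulr_suml -[LHS]mulr_natl; congr (_ * _).
rewrite logn_count_dvd // natr_sum [RHS](big_cat_nat (n := n)) //=; last exact: leqW.
(* The exponents [k >= n] contribute nothing, since then [p ^ k > k >= n]. *)
rewrite [X in _ + X]big_nat_cond [X in _ + X]big1 ?addr0 // => k.
rewrite andbT => /andP[nk _].
by rewrite gtnNdvd // (leq_ltn_trans nk) // ltn_expl // prime_gt1.
Qed.

Lemma sum_multiples (V : nmodType) (d N : nat) (f : nat -> V) : (0 < d)%N ->
  \sum_(0 <= n < N.+1 | (d %| n)%N) f n
    = \sum_(0 <= m < (N %/ d)%N.+1) f (d * m)%N.
Proof.
move=> d0; elim: N => [|N IH].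
  by rewrite div0n big_mkcond !big_nat1 dvdn0 muln0.
rewrite big_mkcond big_nat_recr //= -big_mkcond IH divnS //.
case: ifP => dN; last by rewrite addr0.
rewrite add1n [RHS]big_nat_recr //=; congr (_ + f _).
have := divnS N d0; rewrite dN add1n => <-.
by rewrite mulnC divnK.
Qed.

(** A partial sum of L(1, chi); the term [m = 0] vanishes because [0^-1 = 0]. *)
Definition logsum (R : realType) (chi : nat -> R) (n : nat) : R :=
  \sum_(0 <= m < n.+1) chi m * m%:R^-1.

(** After expanding [ln n] over prime powers and exchanging sums, write [n = p ^ k * m]:
    multiplicativity extracts the prime power and leaves a partial sum of L(1, chi) over [m]. *)
Lemma sum_chi_ln (R : realType) (chi : nat -> R) (N : nat) :
  {morph chi : m n / (m * n)%N >-> m * n} ->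
  \sum_(0 <= n < N.+1) chi n * (ln n%:R / n%:R)
    = \sum_(0 <= p < N.+1 | prime p) ln p%:R *
        \sum_(1 <= k < N.+1) chi (p ^ k)%N * (p ^ k)%N%:R^-1
                             * logsum chi (N %/ p ^ k)%N.
Proof.
move=> chiM.
transitivity (\sum_(0 <= n < N.+1) \sum_(0 <= p < N.+1 | prime p)
    \sum_(1 <= k < N.+1) (p ^ k %| n)%:R * (ln p%:R * (chi n * n%:R^-1))).
  (* The index [n = 0], which the expansion of [ln n] does not cover, gives 0 on both sides through
     [0^-1 = 0]. *)
  rewrite !big_nat; apply: eq_bigr => -[|n] nN.
    rewrite invr0 !mulr0 big1 // => p _; rewrite big1 // => k _.
    by rewrite !mulr0.
  rewrite (@ln_nat_sum_primes _ N) // mulr_suml mulr_sumr.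
  apply: eq_bigr => p _; rewrite mulr_suml mulr_sumr.
  by apply: eq_bigr => k _; ring.
rewrite exchange_big /=; apply: eq_bigr => p pp.
rewrite exchange_big /= mulr_sumr; apply: eq_bigr => k _.
have pk0 : (0 < p ^ k)%N by rewrite expn_gt0 prime_gt0.
rewrite /logsum !mulr_sumr.
under eq_bigr do rewrite mulr_natl mulrb.
rewrite -big_mkcond sum_multiples //; apply: eq_bigr => m _.
by rewrite chiM natrM invfM; ring.
Qed.

Lemma sum_inv_exp_le (R : realFieldType) (p K : nat) : (1 < p)%N ->
  \sum_(2 <= k < K) (p%:R ^+ k)^-1 <= (p%:R * (p%:R - 1))^-1 :> R.
Proof.
move=> p1; have p1R : 1 < p%:R :> R by rewrite ltr1n.
have H n : \sum_(2 <= k < n.+2) (p%:R ^+ k)^-1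
    = (p%:R * (p%:R - 1))^-1 - (p%:R ^+ n.+1 * (p%:R - 1))^-1 :> R.
  elim: n => [|n IH]; first by rewrite big_geq // expr1 subrr.
  rewrite big_nat_recr //= IH !exprS; field.
  by rewrite expf_neq0 ?subr_eq0 !gt_eqF //; lra.
have pos n : 0 <= (p%:R ^+ n * (p%:R - 1))^-1 :> R.
  by rewrite invr_ge0 mulr_ge0 ?exprn_ge0 ?subr_ge0 // ltW.
case: K => [|[|n]]; rewrite ?H ?lerBlDr ?lerDl ?pos //;
  by rewrite big_geq // -[X in X * _]expr1 pos.
Qed.

Lemma ln_succ_le (R : realType) (n : nat) : (0 < n)%N ->
  ln n.+1%:R <= ln n%:R + n%:R^-1 :> R.
Proof.
move=> n0; have n0R : 0 < n%:R :> R by rewrite ltr0n.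
rewrite -lerBlDl -ln_div ?posrE ?ltr0n //.
rewrite -natr1 mulrDl divff ?gt_eqF // mul1r.
by rewrite le_ln1Dx // (lt_le_trans (ltrN10 R)) // invr_ge0 ltW.
Qed.

(* It telescopes: ln n / (n (n - 1)) <= v (n - 1) - v n with v n = (ln n + 2) / n. *)
Lemma sum_ln_div_le (R : realType) (N : nat) :
  \sum_(2 <= n < N) ln n%:R / (n%:R * (n%:R - 1)) <= 2 :> R.
Proof.
have H n : \sum_(2 <= n < n.+2) ln n%:R / (n%:R * (n%:R - 1))
     <= 2 - (ln n.+1%:R + 2) / n.+1%:R :> R.
  elim: n => [|n IH]; first by rewrite big_geq // ln1 add0r divr1 subrr.
  rewrite big_nat_recr //= -lerBrDr (le_trans IH) //.
  have n1 : 1 <= n.+1%:R :> R by rewrite ler1n.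
  have := @ln_succ_le R n.+1 isT.
  have -> : n.+2%:R = n.+1%:R + 1 :> R by rewrite natr1.
  move: (ln (n.+1%:R + 1)) (ln n.+1%:R) => b a.
  move: (n.+1%:R : R) n1 => x x1 ab.
  have x0 : 0 < x by lra.
  rewrite -subr_ge0.
  have -> : 2 - (b + 2) / (x + 1) - b / ((x + 1) * (x + 1 - 1)) -
       (2 - (a + 2) / x) = ((x + 1) * (a - b) + 2) / (x * (x + 1)).
    by field; rewrite !gt_eqF //; lra.
  apply: divr_ge0; last by rewrite mulr_ge0; lra.
  have : (x + 1) * (a - b) >= (x + 1) * - x^-1.
    by rewrite ler_wpM2l; lra.
  have -> : (x + 1) * - x^-1 = - 1 - x^-1 by field; rewrite gt_eqF.
  have : x^-1 <= 1 by rewrite invf_le1.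
  lra.
have pos n : 0 <= (ln n.+1%:R + 2) / n.+1%:R :> R.
  by rewrite divr_ge0 // addr_ge0 // ln_ge0 // ler1n.
case: N => [|[|n]]; [by rewrite big_geq|by rewrite big_geq|].
by rewrite (le_trans (H n)) // lerBlDr lerDl.
Qed.

Lemma ln4_ge1 (R : realType) : 1 <= ln 4 :> R.
Proof.
have h : ln (1 - 2^-1) <= - 2^-1 :> R by rewrite le_ln1Dx //; lra.
have : ln 4 = - ln (1 - 2^-1) *+ 2 :> R.
  rewrite (_ : 1 - 2^-1 = 2^-1); last by field.
  by rewrite lnV ?posrE ?ltr0n // opprK -lnXn // -natrX.
lra.
Qed.

(** Multiplied out, the claim is [ln (n + 1) <= ln n + ln n / n]; it follows from
    [ln (n + 1) <= ln n + 1 / n] and [ln n >= ln 4 >= 1]. *)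
Lemma ln_div_antitone (R : realType) (n : nat) : (4 <= n)%N ->
  0 <= ln (n.+1%:R : R) / n.+1%:R <= ln (n%:R : R) / n%:R.
Proof.
move=> n4; have n0 : (0 < n)%N by exact: leq_trans n4.
have n0R : 0 < n%:R :> R by rewrite ltr0n.
rewrite divr_ge0 ?ln_ge0 ?ler1n //=.
rewrite ler_pdivrMr ?ltr0n // (le_trans (@ln_succ_le _ _ n0)) //.
have -> : ln n%:R / n%:R * n.+1%:R = ln n%:R + ln n%:R * n%:R^-1 :> R.
  by rewrite -natr1; field; rewrite gt_eqF.
rewrite lerD2l ler_peMl ?invr_ge0 ?ler0n // (le_trans (ln4_ge1 R)) //.
by rewrite ler_ln ?posrE ?ltr0n // ler_nat.
Qed.

Lemma bounded_sum_chi_ln (R : realType) (chi : nat -> R) (B : R) :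
  (forall k l, `|\sum_(k <= i < l) chi i| <= B) ->
  exists C, forall N, `|\sum_(0 <= n < N) chi n * (ln n%:R / n%:R)| <= C.
Proof.
move=> chiB; pose f n := chi n * (ln n%:R / n%:R).
have B0 : 0 <= B by apply: le_trans (chiB 0%N 0%N).
have u4 : 0 <= ln 4 / 4 :> R by rewrite divr_ge0 // (le_trans ler01) // ln4_ge1.
(* The first four terms are bounded individually, as [ln n / n] is known to decrease only from 4
   on. *)
exists (\sum_(0 <= n < 4) `|f n| + B * (ln 4 / 4)) => N.
have [N4|/ltnW N4] := leqP N 4.
  rewrite (big_cat_nat _ N4) //= -addrA (le_trans (ler_norm_sum _ _ _)) //.
  by rewrite lerDl addr_ge0 ?sumr_ge0 // mulr_ge0.
rewrite (big_cat_nat _ N4) //= (le_trans (ler_normD _ _)) //.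
rewrite lerD ?ler_norm_sum //.
exact: (@norm_sum_antitone_le _ _ (fun n => ln n%:R / n%:R) _ _ _ N4 chiB
  (@ln_div_antitone R)).
Qed.

Lemma logsum_tail (R : realType) (chi : nat -> R) (B : R) :
  (forall k l, `|\sum_(k <= i < l) chi i| <= B) ->
  exists L, forall n, `|logsum chi n - L| <= B / n.+1%:R.
Proof.
move=> chiB.
have [i i0|||L _ HL] := @dirichlet_test R chi (fun i => i%:R^-1) B 1 chiB.
- by rewrite invr_ge0 ler0n lef_pV2 ?posrE ?ltr0n ?ler_nat //=.
- by rewrite invr1.
- by rewrite -cvg_shiftS; exact: cvg_harmonic.
by exists L => n; apply: HL.
Qed.

(** Mertens's argument. In [sum_chi_ln], the terms [k = 1] give [A * L] plus the error [E1] of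
    replacing partial sums by [L]; the terms [k >= 2] form [E2]. All but [A * L] being bounded, one
    divides by [L]. *)
Lemma bounded_sum_primes (R : realType) (chi : nat -> R) (B L : R) :
  {morph chi : m n / (m * n)%N >-> m * n} -> (forall n, `|chi n| <= 1) ->
  (forall k l, `|\sum_(k <= i < l) chi i| <= B) ->
  (forall n, `|logsum chi n - L| <= B / n.+1%:R) -> L != 0 ->
  exists C, forall N,
    `|\sum_(0 <= p < N | prime p) chi p * (ln p%:R / p%:R)| <= C.
Proof.
move=> chiM chi1 chiB hL L0.
have B0 : 0 <= B by apply: le_trans (chiB 0%N 0%N).
have [C HC] := bounded_sum_chi_ln chiB.
pose M := `|L| + B.
have lM n : `|logsum chi n| <= M.
  rewrite -(subrK L (logsum chi n)) (le_trans (ler_normD _ _)) // addrC lerD2l.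
  by rewrite (le_trans (hL n)) // ler_pdivrMr ?ltr0n // ler_peMr // ler1n.
have C0 : 0 <= C by apply: le_trans (HC 0%N).
have M0 : 0 <= M by rewrite addr_ge0.
have ln40 : 0 <= ln 4 :> R by rewrite (le_trans ler01) // ln4_ge1.
have K0 : 0 <= (C + B * ln 4 + M * 2) / `|L|.
  by rewrite divr_ge0 // !addr_ge0 // mulr_ge0.
exists ((C + B * ln 4 + M * 2) / `|L|) => -[|[|N]];
  [by rewrite big_geq // normr0|by rewrite big_mkcond big_nat1 normr0|].
set A := \sum_(_ <= _ < _ | _) _.
pose E1 := \sum_(0 <= p < N.+2 | prime p)
  ln p%:R * (chi p / p%:R * (logsum chi (N.+1 %/ p)%N - L)).
pose E2 := \sum_(0 <= p < N.+2 | prime p) ln p%:R *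
  \sum_(2 <= k < N.+2) chi (p ^ k)%N * (p ^ k)%N%:R^-1
                       * logsum chi (N.+1 %/ p ^ k)%N.
have dec : \sum_(0 <= n < N.+2) chi n * (ln n%:R / n%:R) = A * L + E1 + E2.
  rewrite sum_chi_ln // /A mulr_suml -!big_split /=; apply: eq_bigr => p _.
  by rewrite big_ltn // expn1; ring.
have ln_nneg q : prime q -> 0 <= ln q%:R :> R.
  by move=> /prime_gt0 q0; rewrite ln_ge0 // ler1n.
(* The error at [p] is at most [B / (floor ((N + 1) / p) + 1) <= B * p / (N + 1)], so [E1] is at
   most [B / (N + 1)] times [theta (N + 1)]. *)
have E1B : `|E1| <= B * ln 4.
  rewrite (le_trans (ler_norm_sum _ _ _)) //.
  apply: le_trans (_ : B / N.+1%:R * theta R N.+1 <= _); last first.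
    rewrite mulrAC ler_pdivrMr ?ltr0n // -mulrA ler_wpM2l //.
    by rewrite [leRHS]mulrC theta_le.
  rewrite /theta mulr_sumr; apply: ler_sum => p pp.
  have p0R : 0 < p%:R :> R by rewrite ltr0n prime_gt0.
  rewrite normrM (ger0_norm (ln_nneg p pp)) mulrC ler_wpM2r ?ln_nneg //.
  rewrite !normrM (ger0_norm (ltW _ : 0 <= p%:R^-1)) ?invr_gt0 //.
  apply: le_trans (_ : p%:R^-1 * (B / (N.+1 %/ p).+1%:R) <= _).
    by rewrite ler_pM ?mulr_ge0 ?invr_ge0 ?ler0n // ler_piMl // invr_ge0 ler0n.
  rewrite mulrCA -invfM ler_wpM2l // lef_pV2 ?posrE ?mulr_gt0 ?ltr0n ?(prime_gt0 pp) //.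
  by rewrite -natrM ler_nat mulnC ltnW // ltn_ceil // prime_gt0.
(* Partial sums are at most [M], and the geometric tail over [k >= 2] is at most
   [1 / (p (p - 1))]. *)
have E2B : `|E2| <= M * 2.
  rewrite (le_trans (ler_norm_sum _ _ _)) //.
  apply: le_trans (_ : \sum_(0 <= p < N.+2 | prime p)
      M * (ln p%:R / (p%:R * (p%:R - 1))) <= _).
    apply: ler_sum => q qp.
    rewrite normrM (ger0_norm (ln_nneg q qp)) mulrCA ler_wpM2l ?ln_nneg //.
    rewrite (le_trans (ler_norm_sum _ _ _)) //.
    rewrite (le_trans _ (ler_wpM2l _ (@sum_inv_exp_le R q N.+2 (prime_gt1 qp)))) //.
    rewrite mulr_sumr; apply: ler_sum => k _.
    rewrite !normrM mulrC ler_pM // natrX.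
    rewrite [X in _ * X]ger0_norm ?invr_ge0 ?exprn_ge0 //.
    by rewrite ler_piMl // invr_ge0 exprn_ge0.
  rewrite -mulr_sumr ler_wpM2l //.
  rewrite (le_trans _ (@sum_ln_div_le R N.+2)) //.
  rewrite big_mkcond (big_cat_nat (n := 2)) //= [X in X + _]big_nat_recr //= big_nat1.
  rewrite !add0r; apply: ler_sum => q _ /=.
  case: ifP => // _; case: q => [|q]; first by rewrite mul0r invr0 mulr0.
  by rewrite divr_ge0 ?mulr_ge0 ?subr_ge0 ?ln_ge0 ?ler1n.
rewrite ler_pdivlMr ?normr_gt0 // -normrM.
have -> : A * L = \sum_(0 <= n < N.+2) chi n * (ln n%:R / n%:R) - E1 - E2.
  by rewrite dec; ring.
rewrite !(le_trans (ler_normB _ _)) // lerD // (le_trans (ler_normB _ _)) //.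
by rewrite lerD.
Qed.

(** Dirichlet's test with the weights [1 / ln p] removes the logarithm; a block is a difference of
    two initial sums, hence the bound [C + C]. *)
Lemma cvg_sum_chi_primes (R : realType) (chi : nat -> R) (C : R) :
  (forall N, `|\sum_(0 <= p < N | prime p) chi p * (ln p%:R / p%:R)| <= C) ->
  cvgn (series (fun p => if prime p then chi p / p%:R else 0)).
Proof.
move=> HC; pose a p := if prime p then chi p * (ln p%:R / p%:R) else 0.
have aE k : \sum_(0 <= p < k) a p = \sum_(0 <= p < k | prime p) chi p * (ln p%:R / p%:R).
  by rewrite [RHS]big_mkcond.
have aB k l : `|\sum_(k <= p < l) a p| <= C + C.
  have [lk|/ltnW kl] := leqP l k.
    by rewrite big_geq // normr0 addr_ge0 // (le_trans _ (HC 0%N)).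
  have := aE l; rewrite (big_cat_nat (leq0n k) kl) /= aE => /(canRL (addKr _))->.
  by rewrite addrC (le_trans (ler_normB _ _)) // lerD.
have ln2 i : (2 <= i)%N -> 0 < ln i%:R :> R by move=> i2; rewrite ln_gt0 // ltr1n.
have [i i2|||L cvL _] := @dirichlet_test R a (fun i => (ln i%:R)^-1) _ 2 aB.
- rewrite invr_ge0 ltW ?ln2 1?leqW //= lef_pV2 ?posrE ?ln2 1?leqW //.
  by rewrite ler_ln ?posrE ?ltr0n ?ler_nat // ltnW.
- by rewrite invr_ge0 ltW // ln2.
- apply/(gtr0_cvgV0 (f := fun i => ln i%:R)).
    by exists 2%N => // i; exact: ln2.
  apply/cvgryPge => A; have /cvgryPge/(_ (expR A)) := @cvgr_idn R.
  apply: filterS => i Ai; rewrite -[A]expRK ler_ln ?posrE ?expR_gt0 //.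
  by rewrite (lt_le_trans (expR_gt0 A)).
rewrite (_ : (fun p => _) = fun p => a p * (ln p%:R)^-1); first by apply/cvg_ex; exists L.
apply/funext => p; rewrite /a.
case: ifP => [pp|]; last by rewrite mul0r.
by field; rewrite pnatr_eq0 -lt0n prime_gt0 // gt_eqF // ln2 // prime_gt1.
Qed.

(** * Convergence and positivity of the product over primes *)

Lemma ln_1B_bounds (R : realType) (x : R) : `|x| <= 2^-1 ->
  `|ln (1 - x) + x| <= 2 * x ^+ 2.
Proof.
rewrite ler_norml => /andP[xl xu].
have x1 : 0 < 1 - x by lra.
have u : ln (1 - x) <= - x by rewrite le_ln1Dx; lra.
(* The lower bound is the upper bound [ln (1 + y) <= y] for [1 + y = 1 / (1 - x)]. *)
have l : ln (1 - x) >= - (x / (1 - x)).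
  rewrite lerNl -lnV ?posrE //.
  rewrite [X in ln X](_ : _ = 1 + x / (1 - x)); last by field; rewrite gt_eqF.
  rewrite le_ln1Dx // ltr_pdivlMr //; lra.
rewrite ler_norml; apply/andP; split; last by have := sqr_ge0 x; lra.
have : x / (1 - x) <= x + 2 * x ^+ 2.
  rewrite ler_pdivrMr // -subr_ge0.
  have -> : (x + 2 * x ^+ 2) * (1 - x) - x = x ^+ 2 * (1 - 2 * x) by ring.
  by rewrite mulr_ge0 ?sqr_ge0 //; lra.
lra.
Qed.

Lemma cvg_series_inv_sqr (R : realType) (K : R) : 0 <= K ->
  cvgn (series (fun n => K / n%:R ^+ 2)).
Proof.
move=> K0; apply: nondecreasing_is_cvgn.
  apply/nondecreasing_series => n _ _.
  by rewrite divr_ge0 // exprn_ge0.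
exists (K * 2) => _ [n _ <-]; rewrite /series /=.
have H m : \sum_(0 <= i < m.+2) K / i%:R ^+ 2 <= K * 2 - K / m.+1%:R.
  elim: m => [|m IH].
    rewrite big_nat_recr //= big_nat1 expr0n invr0 mulr0 add0r expr1n; lra.
  rewrite big_nat_recr //= (le_trans (lerD IH (lexx _))) // -subr_ge0.
  have m0 : 0 < m.+1%:R :> R by rewrite ltr0n.
  have -> : m.+2%:R = m.+1%:R + 1 :> R by rewrite natr1.
  move: (m.+1%:R : R) m0 => x x0.
  have -> : K * 2 - K / (x + 1) - (K * 2 - K / x + K / (x + 1) ^+ 2)
     = K / (x * (x + 1) ^+ 2) by field; rewrite !gt_eqF //; lra.
  by rewrite divr_ge0 // mulr_ge0 ?exprn_ge0; lra.
have B m : K * 2 - K / m.+1%:R <= K * 2 by rewrite lerBlDr lerDl divr_ge0.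
case: n => [|[|n]]; last by apply: le_trans (H n) _.
  by rewrite big_geq // mulr_ge0.
by rewrite big_nat1 expr0n invr0 mulr0 mulr_ge0.
Qed.

(** The series of [t + y] converges absolutely. It is applied to the logarithms [t] of the factors
    and [y p = chi p / p]. *)
Lemma cvg_series_dist (R : realType) (t y : nat -> R) (K : R) : 0 <= K ->
  (forall n, `|t n + y n| <= K / n%:R ^+ 2) ->
  cvgn (series y) -> cvgn (series t).
Proof.
move=> K0 tyK cy.
have cty : cvgn (series (t + y)).
  apply: normed_cvg; apply: series_le_cvg (cvg_series_inv_sqr K0) => n //=;
    last exact: tyK.
  by rewrite divr_ge0 // exprn_ge0.
have := is_cvg_seriesB cty cy; rewrite (_ : t + y - y = t) //.
by apply/funext => n; rewrite !fctE addrK.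
Qed.

Lemma lim_prod_gt0 (R : realType) (f : nat -> R) : (forall n, 0 < f n) ->
  cvgn (series (fun n => ln (f n))) ->
  0 < limn (fun n => \prod_(0 <= i < n) f i).
Proof.
move=> f0 cf.
have -> : (fun n => \prod_(0 <= i < n) f i) = expR \o series (fun n => ln (f n)).
  apply/funext => n /=; rewrite /series /= -ln_prod // lnK // posrE prodr_gt0 //.
suff /cvg_lim -> : expR \o series (fun n => ln (f n)) @ \oo -->
    expR (limn (series (fun n => ln (f n)))) by [exact: expR_gt0|].
by apply: continuous_cvg cf; exact: continuous_expR.
Qed.

(** The logarithm of a factor is [- chi p / p] up to [O(1 / p ^ 2)]. The primes outside [P] are at
    most [N], so they only affect the constant. *)
Lemma lim_prod_primes_gt0 (R : realType) (chi chi' : nat -> R) (C : R) (N : nat)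
    (P : pred nat) :
  (forall n, `|chi n| <= 1) ->
  (forall N, `|\sum_(0 <= p < N | prime p) chi p * (ln p%:R / p%:R)| <= C) ->
  (forall p, prime p -> P p -> (2 < p)%N /\ chi' p = chi p) ->
  (forall p, prime p -> (N < p)%N -> P p) ->
  0 < limn (fun n => \prod_(0 <= p < n | prime p && P p) (1 - chi' p / (p%:R - 1))).
Proof.
move=> chi1 HC P2 PN.
pose x p := if prime p && P p then chi p / (p%:R - 1) else 0.
(* Since [p >= 3] on [P], the factors are positive and the logarithm estimate applies. *)
have xhalf p : `|x p| <= 2^-1.
  rewrite /x; case: ifP => [/andP[pp Pp]|_]; last by rewrite normr0 invr_ge0.
  have [p3 _] := P2 p pp Pp.
  have pR : 3 <= p%:R :> R by rewrite ler_nat.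
  rewrite normrM normfV (ger0_norm (_ : 0 <= p%:R - 1)); last lra.
  by rewrite ler_pdivrMr; [have := chi1 p; lra|lra].
have -> : (fun n => \prod_(0 <= p < n | prime p && P p) (1 - chi' p / (p%:R - 1)))
    = (fun n => \prod_(0 <= p < n) (1 - x p)).
  apply/funext => n; rewrite big_mkcond; apply: eq_bigr => p _.
  rewrite /x; case: ifP => [/andP[pp Pp]|_]; last by rewrite subr0.
  by have [_ ->] := P2 p pp Pp.
apply: lim_prod_gt0 => [n|].
  by have := xhalf n; rewrite ler_norml => /andP[_]; lra.
(* On [P], [p / (p - 1) <= 2] bounds the error times [p ^ 2] by [2 * 4 + 2 = 10]. A prime outside
   [P] leaves [chi p / p], which times [p ^ 2] is at most [p <= N]. *)
apply: (@cvg_series_dist _ _ _ (10 + N%:R) _ _ (cvg_sum_chi_primes HC)).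
  by rewrite addr_ge0.
move=> p; rewrite /x; case: (boolP (prime p)) => pp; last first.
  by rewrite /= subr0 ln1 addr0 normr0 divr_ge0 ?exprn_ge0 ?addr_ge0.
have p0 : 0 < p%:R :> R by rewrite ltr0n prime_gt0.
rewrite ler_pdivlMr ?exprn_gt0 //.
case: ifP => /= [Pp|nP].
  have := ln_1B_bounds (xhalf p); rewrite /x pp Pp /=.
  have [p3 _] := P2 p pp Pp.
  have pR : 3 <= p%:R :> R by rewrite ler_nat.
  have chiB := chi1 p.
  move: (ln _) => l.
  move: (chi p) (p%:R : R) pR chiB => c q q3 c1.
  have q1 : 0 < q - 1 by lra.
  have -> : l + c / q = (l + c / (q - 1)) - c / (q * (q - 1)).
    by field; rewrite !gt_eqF //; lra.
  move=> lx; apply: le_trans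
    (_ : (2 * (c / (q - 1)) ^+ 2 + `|c| / (q * (q - 1))) * q ^+ 2 <= _).
    rewrite ler_wpM2r ?exprn_ge0 //; first lra.
    rewrite (le_trans (ler_normB _ _)) // lerD // normrM normfV.
    by rewrite (ger0_norm (_ : 0 <= q * (q - 1))) // mulr_ge0; lra.
  have -> : (2 * (c / (q - 1)) ^+ 2 + `|c| / (q * (q - 1))) * q ^+ 2
     = 2 * c ^+ 2 * (q / (q - 1)) ^+ 2 + `|c| * (q / (q - 1)).
    by field; rewrite !gt_eqF //; lra.
  have h : 0 <= q / (q - 1) <= 2 by rewrite divr_ge0 ?ler_pdivrMr //=; lra.
  have c2 : c ^+ 2 <= 1 by rewrite -real_normK ?num_real // expr_le1.
  have c0 := normr_ge0 c; have c20 := sqr_ge0 c.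
  move: (q / (q - 1)) h => h /andP[h0 h2].
  have h4 : h ^+ 2 <= 4 by nra.
  have : c ^+ 2 * h ^+ 2 <= 1 * 4 by rewrite ler_pM // sqr_ge0.
  have : `|c| * h <= 1 * 2 by rewrite ler_pM.
  have : 0 <= N%:R :> R by [].
  lra.
have pN : (p <= N)%N by rewrite leqNgt; apply/negP => /(PN p pp); rewrite nP.
rewrite subr0 ln1 add0r normrM normfV (ger0_norm (ltW p0)).
rewrite expr2 mulrA divfK ?gt_eqF // (le_trans (_ : _ <= p%:R)) //.
  by rewrite ler_piMl // ltW.
by rewrite (le_trans (_ : _ <= N%:R)) ?ler_nat // lerDr.
Qed.

(** * Nonvanishing at 1 *)

(** Full periods sum to 0 and are removed from the end until at most [q] terms remain. *)
Lemma norm_sum_periodic_le (R : numDomainType) (f : nat -> R) (q : nat) :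
  (0 < q)%N ->
  (forall i, `|f i| <= 1) -> (forall i, f (i + q)%N = f i) ->
  \sum_(0 <= i < q) f i = 0 ->
  forall k l, `|\sum_(k <= i < l) f i| <= q%:R.
Proof.
move=> q0 f1 fq f0 k.
have period m : \sum_(m <= i < m + q) f i = 0.
  elim: m => [|m IH]; first by rewrite add0n.
  rewrite addSn big_nat_recr /= ?fq; last by lia.
  by rewrite addrC -big_ltn // -[X in (X <= _)%N]addn0 ltn_add2l.
elim/ltn_ind => l IH.
have [lk|kl] := leqP l (k + q).
  rewrite (le_trans (ler_norm_sum _ _ _)) //.
  rewrite (le_trans (ler_sum _ (fun i _ => f1 i))) //.
  by rewrite big_const_nat iter_addr_0 ler_nat leq_subLR.
have -> : \sum_(k <= i < l) f i = \sum_(k <= i < l - q) f i.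
  rewrite (big_cat_nat (n := (l - q)%N)) /=; [|lia|lia].
  have := period (l - q)%N; rewrite subnK; last by lia.
  by move->; rewrite addr0.
by apply: IH; lia.
Qed.

Lemma legendre_addn (q n : nat) : prime q -> odd q ->
  legendre (n + q)%N q = legendre n q.
Proof.
move=> pq oq; apply: legendre_intr => //; rewrite PoszD rmorphD /=.
by rewrite -[X in _ + X = _]/(q%:R) (pcharf0 (pchar_Fp pq)) addr0.
Qed.

(** The reflection [i -> q - i] changes every sign, because -1 is a nonresidue. *)
Lemma legendre_sum0 (q : nat) : prime q -> (q %% 4 = 3)%N ->
  \sum_(0 <= i < q) legendre i q = 0.
Proof.
move=> pq q4; have oq : odd q by lia.
have q0 := prime_gt0 pq.
rewrite big_ltn // {1}/legendre dvdz0 add0r.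
set S := \sum_(_ <= _ < _) _.
suff : S = - S by lia.
rewrite {1}/S big_nat_rev -sumrN !big_nat; apply: eq_bigr => i /andP[i1 iq].
rewrite -mulN1r -(legendreN1 pq q4) -legendreM //; apply: legendre_intr => //.
have -> : (1 + q - i.+1)%N = (q - i)%N by lia.
rewrite -subzn 1?ltnW // mulN1r !rmorphB rmorphN /=.
by rewrite -[q%:~R]/(q%:R) (pcharf0 (pchar_Fp pq)) sub0r.
Qed.

(** A form of the symbol fit for evaluation: a list of squares replaces the quantifier over
    ['I_q]. *)
Definition legendre_table (q : nat) : seq int :=
  let sq := [seq (x * x %% q)%N | x <- iota 0 q] in
  mkseq (fun n => if n == 0%N then 0 else if n \in sq then 1 else -1) q.

Lemma legendre_tableE (q m : nat) : (0 < q)%N ->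
  nth 0 (legendre_table q) (m %% q) = legendre m q.
Proof.
move=> q0; rewrite nth_mkseq ?ltn_mod // /legendre dvdzE /= /dvdn.
have sqE (x : nat) : (q %| x%:Z ^+ 2 - m%:Z)%Z = (x * x %% q == m %% q)%N.
  by rewrite -eqz_mod_dvd expr2 -PoszM !modz_nat eqz_nat.
suff -> : ((m %% q)%N \in [seq (x * x %% q)%N | x <- iota 0 q])
    = [exists x : 'I_q, (q %| (x : nat)%:Z ^+ 2 - m%:Z)%Z] by [].
apply/mapP/existsP => [[x]|[x]].
  rewrite mem_iota add0n /= => xq mx.
  by exists (Ordinal xq); rewrite sqE /= mx.
by rewrite sqE => /eqP xm; exists (x : nat); rewrite ?mem_iota ?ltn_ord.
Qed.

(* The divisions are done in binary so that the kernel can evaluate them. *)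
Definition logsum_floor (q M n : nat) : int :=
  let tab := legendre_table q in
  let M' := BinInt.Z.of_nat M in
  let quot m :=
    BinInt.Z.div (Z_of_int (nth 0 tab (m %% q)%N) * M') (BinInt.Z.of_nat m) in
  foldr (fun m s => int_of_Z (quot m) + s) 0 (iota 1 n).

(** [BinInt.Z.div] by a positive number rounds down for negative numerators too, so every term is
    bounded from below. *)
Lemma logsum_floor_le (R : realType) (q M n : nat) : (0 < q)%N ->
  (logsum_floor q M n)%:~R <=
    M%:R * logsum (fun m => (legendre m q)%:~R : R) n.
Proof.
move=> q0; rewrite /logsum big_ltn // invr0 mulr0 add0r /index_iota subn1 [n.+1.-1]/=.
have : all (fun m => 0 < m)%N (iota 1 n).
  by apply/allP => m; rewrite mem_iota => /andP[].
rewrite /logsum_floor; elim: (iota 1 n) => [|m s IH].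
  by rewrite big_nil mulr0.
case/andP => m0 /IH {}IH; rewrite big_cons mulrDr [foldr _ _ _]/= intrD lerD //.
rewrite mulrA ler_pdivlMr ?ltr0n // -[m%:R]/(m%:Z%:~R) -intrM.
rewrite [M%:R * _]mulrC -[M%:R]/(M%:Z%:~R) -intrM ler_int legendre_tableE //.
move: (legendre m q) => c {IH}.
have := BinInt.Z.mul_div_le (Z_of_int c * BinInt.Z.of_nat M) (BinInt.Z.of_nat m).
set z := BinInt.Z.div _ _; lia.
Qed.

(** This says that the partial sum up to [5 D - 1] exceeds 1/5, the value [D / (5 D)] of the
    remainder bound there; hence L(1, chi) is nonzero. *)
Lemma logsum_floor_gt (D : nat) : D \in cmDs ->
  ((10 ^ 4)%N%:Z < 5 * logsum_floor D (10 ^ 4) (5 * D).-1)%R.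
Proof.
by rewrite !inE; do 5?[case/orP]; move=> /eqP->; vm_compute.
Qed.

(** * The vanishing criterion *)

Lemma cmDs_prime (D : nat) : D \in cmDs -> prime D /\ (D %% 4 = 3)%N.
Proof. by rewrite !inE; do 5?[case/orP]; move=> /eqP->. Qed.

Lemma norm_legendre_le1 (R : numDomainType) (a : int) (p : nat) :
  `|(legendre a p)%:~R : R| <= 1.
Proof. by case: legendreP => _; rewrite ?normr0 ?normrN ?normr1. Qed.

Lemma lim_prod_legendre_gt0 (R : realType) (D : nat) (r : int) :
  D \in cmDs -> r != 0 ->
  0 < limn (fun n => \prod_(0 <= p < n | prime p && ~~ (p %| 2 * r)%Z)
                      (1 - (legendre (- D%:Z) p)%:~R / (p%:R - 1)) : R).
Proof.
move=> hD r0; have [pD D4] := cmDs_prime hD.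
have oD : odd D by lia.
have D0 := prime_gt0 pD.
pose chi n : R := (legendre n%:Z D)%:~R.
have chi1 n : `|chi n| <= 1 by exact: norm_legendre_le1.
have chiM : {morph chi : m n / (m * n)%N >-> m * n}.
  by move=> m n; rewrite /chi PoszM legendreM // intrM.
have chiB k l : `|\sum_(k <= i < l) chi i| <= D%:R.
  apply: norm_sum_periodic_le => // [i|]; first by rewrite /chi legendre_addn.
  by rewrite -rmorph_sum legendre_sum0.
have [L hL] := logsum_tail chiB.
have L0 : L != 0.
  have := logsum_floor_gt hD; rewrite -(ltr_int R) intrM => lb.
  have := hL (5 * D).-1; rewrite prednK ?muln_gt0 //.
  rewrite natrM invfM mulrCA divff ?pnatr_eq0 -?lt0n // mulr1.
  have := logsum_floor_le R (10 ^ 4) (5 * D).-1 D0.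
  rewrite -/chi; move: (logsum chi _) lb => x lb ub.
  rewrite ler_norml => /andP[_ xL].
  apply/eqP => L0; move: xL; rewrite {}L0 subr0 => xL.
  have : (10 ^ 4)%N%:R * x <= (10 ^ 4)%N%:R * 5^-1 :> R by rewrite ler_wpM2l.
  rewrite -[(10 ^ 4)%N%:~R]/((10 ^ 4)%N%:R : R) in lb.
  rewrite (_ : 5%:~R = 5) // in lb.
  move: ((10 ^ 4)%N%:R : R) (_%:~R : R) lb ub => y z; lra.
have [C HC] := bounded_sum_primes chiM chi1 chiB hL L0.
(* A prime above [|2 r|] cannot divide [2 r], and one not dividing [2 r] is odd, so reciprocity
   applies to it. *)
apply: (lim_prod_primes_gt0 (N := absz (2 * r))
  (chi' := fun p => (legendre (- D%:Z) p)%:~R)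
  (P := fun p => ~~ (p %| 2 * r)%Z) chi1 HC) => p pp.
  move=> npr; have p2 : p != 2%N by apply: contraNneq npr => ->; exact: dvdz_mulr.
  have op : odd p by case: (even_prime pp) p2 => [->|].
  split; last by rewrite legendre_reciprocity.
  by have := prime_gt1 pp; move: p2; case: p {pp npr op} => [|[|[|]]].
move=> pr; rewrite dvdzE /= gtnNdvd // absz_gt0 mulf_neq0 //.
Qed.

(** Of the six values of [D], only 7 is not 3 modulo 8. *)
Lemma hDr_eq0 (R : realType) (D : nat) (r : int) :
  D \in cmDs -> r != 0 -> (hDr R D r == 0) = ~~ (2 %| r)%Z && (D == 7%N).
Proof.
move=> hD r0; rewrite /hDr mulf_eq0 orbC gt_eqF ?lim_prod_legendre_gt0 //=.
have [pD _] := cmDs_prime hD.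
have D0 := prime_gt0 pD.
have c0 : 0 < Num.sqrt D%:R / (totient D)%:R :> R.
  by rewrite divr_gt0 ?sqrtr_gt0 ?ltr0n ?totient_gt0.
rewrite mulf_eq0 (gt_eqF c0) orbF /xi {pD D0 c0}.
case: (2 %| r)%Z; first by rewrite oner_eq0.
by move: hD; rewrite !inE; do 5?[case/orP]; move=> /eqP->; rewrite ?pnatr_eq0 ?eqxx.
Qed.

(** * The size of [Omega2] *)

Variant omega_spec (R : realType) : R -> bool -> bool -> Prop :=
| OmegaOne : omega_spec 1 true false
| OmegaNegOne : omega_spec (-1) false true
| OmegaSmall w of `|w| < 1 : omega_spec w false false.

(** The denominator is at least 3 for [p >= 5]. For [p = 3] it is [2 - (-D / 3)], equal to 1 for
    [D = 11] and to 3 for the other [D]. *)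
Lemma omega_factor (R : realType) (D p : nat) : D \in cmDs -> prime p -> odd p ->
  p != D -> let f : R := -1 / (p%:R - 1 - (legendre (- D%:Z) p)%:~R) in
  if (p == 3%N) && (D == 11%N) then f = -1 else `|f| < 1.
Proof.
move=> hD pp op pD /=.
case: ifP => [/andP[/eqP-> /eqP->]|].
  rewrite legendre_reciprocity //.
  rewrite -(legendre_tableE 3 (isT : (0 < 11)%N)).
  rewrite (_ : nth _ _ _ = 1); last by vm_compute.
  by rewrite (_ : 3 - 1 - 1 = 1) ?divr1 //; lra.
have leg1 := @norm_legendre_le1 R (- D%:Z) p.
move=> np; rewrite normrM normrN normr1 mul1r normfV.
suff h : 1 < p%:R - 1 - (legendre (- D%:Z) p)%:~R :> R.
  by rewrite gtr0_norm ?(lt_trans ltr01) // invf_lt1 ?(lt_trans ltr01).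
have [p3|p3] := eqVneq p 3%N.
  move: np; rewrite {leg1 pp op}p3 eqxx /= in pD * => D11.
  have -> : legendre (- D%:Z) 3 = -1; last by rewrite rmorphN1; lra.
  have [prD D4] := cmDs_prime hD.
  rewrite legendre_reciprocity // -legendre_tableE ?prime_gt0 // {prD D4}.
  by move: hD D11; rewrite !inE; do 5?[case/orP]; move=> /eqP-> // _; vm_compute.
have p5 : (5 <= p)%N.
  have := prime_gt1 pp; move: p3 op.
  by case: p {pp pD np leg1} => [|[|[|[|[|]]]]].
have : 5 <= p%:R :> R by rewrite ler_nat.
by move: leg1; rewrite ler_norml => /andP[_]; lra.
Qed.

(** With [Q] the list of primes occurring in [Omega2], the first flag says that [Q] is empty, the
    second that [Q] is [[:: 3]] and [D = 11]. *)
Lemma omegaP (R : realType) (D : nat) (r g : int) (E := CMCurve D g) (g1 := cm_g1 E) :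
  D \in cmDs -> g != 0 ->
  omega_spec (Omega2 R D g1 r) (frakA 2 g1 %| r)%Z
    ((2%N \in calJ E 3 r) && (D == 11%N)).
Proof.
move=> hD g0; have [_ g10 cop] := cm_decomposition hD g0; rewrite -/E -/g1 in g10 cop.
pose S := [seq p <- primes g1 | ~~ (2 %| logn p g1)%N].
pose Q := [seq p <- S | ~~ (p%:Z %| r)%Z].
have Sp : all prime S by apply/allP => p; rewrite mem_filter mem_primes => /and3P[].
have uS : uniq S by rewrite filter_uniq ?primes_uniq.
have uQ : uniq Q by rewrite filter_uniq.
have frakAE (n : int) : (frakA 2 g1 %| n)%Z = all (fun p => (p%:Z %| n)%Z) S.
  by rewrite /frakA -big_filter -/S dvdzE /= prod_primes_dvd.
have OE : Omega2 R D g1 r =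
    \prod_(p <- Q) (-1 / (p%:R - 1 - (legendre (- D%:Z) p)%:~R)).
  rewrite /Omega2 [RHS]big_filter /= big_filter_cond; apply: eq_bigl => p.
  by rewrite andbC.
have fP p : p \in Q ->
    let f : R := -1 / (p%:R - 1 - (legendre (- D%:Z) p)%:~R) in
    if (p == 3%N) && (D == 11%N) then f = -1 else `|f| < 1.
  rewrite !mem_filter => /and3P[_ _]; rewrite mem_primes => /and3P[pp _ pg].
  move: cop; rewrite coprimeMr coprimen2 => /andP[og copD].
  apply: omega_factor => //; first exact: dvdn_odd pg og.
  apply: contraTneq copD => <-.
  by rewrite coprime_sym prime_coprime // pg.
(* The divisibility of [3 r] by [frakA] says that every prime of [S] not dividing [r] is 3; the
   other conditions put 3 in [Q]. *)
have JE : (2%N \in calJ E 3 r) = [&& 3%N \in Q & all (pred1 3%N) Q].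
  rewrite inE /= -/g1 frakAE [all _ Q]all_filter !mem_filter -logn_gt0 andbCA !andbA.
  congr (_ && _).
    by case: (logn 3 g1) => [|n] /=; rewrite ?dvdn0 ?andbF ?andbT.
  apply: eq_in_all => p pS; have pp := allP Sp _ pS.
  rewrite [in LHS]dvdzE abszM Euclid_dvdM // dvdn_prime2 //= dvdzE.
  by case: (p == 3%N); case: dvdn.
rewrite OE JE frakAE.
have -> : all (fun p => (p%:Z %| r)%Z) S = (Q == [::]).
  by rewrite -size_eq0 size_filter -leqn0 leqNgt -has_count has_predC negbK.
case: Q uQ fP {OE JE} => [|p Q] /=; first by rewrite big_nil => _ _; constructor.
case/andP=> pQ uQ fP.
have fle1 q : q \in p :: Q ->
    `|-1 / (q%:R - 1 - (legendre (- D%:Z) q)%:~R) : R| <= 1.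
  move=> /fP /=; case: ifP => _; last exact: ltW.
  by move=> ->; rewrite normrN normr1.
(* Either all factors are the exceptional one and [Q], having no repetition, is [[:: 3]]; or some
   factor is below 1 in absolute value while the others are at most 1. *)
case: (boolP (all (fun q => (q == 3%N) && (D == 11%N)) (p :: Q))) => [|/allPn[q qQ nq]].
  rewrite /= => /andP[/andP[/eqP p3 D11] /allP Q3].
  have Q0 : Q = [::].
    case: Q Q3 pQ {uQ fP fle1} => // q Q Q3; rewrite inE p3.
    by have /andP[/eqP-> _] := Q3 q (mem_head _ _); rewrite eqxx.
  have := fP p (mem_head _ _); rewrite p3 D11 /= => f1.
  by rewrite Q0 big_seq1 f1; constructor.
have -> : ((3%N \in p :: Q) && ((p == 3%N) && all (pred1 3%N) Q)) && (D == 11%N) = false.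
  apply/negP => /andP[/andP[_ all3] D11]; move: nq; rewrite D11 andbT.
  by have /allP/(_ q qQ) /= -> := (all3 : all (pred1 3%N) (p :: Q)).
have := fP q qQ; rewrite (negPf nq) /= => fq1.
constructor; rewrite (big_rem q qQ) normrM -[ltRHS]mul1r.
apply: le_lt_trans (_ : _ <= `|-1 / (q%:R - 1 - (legendre (- D%:Z) q)%:~R) : R|) _.
  rewrite ler_piMr // normr_prod big_seq prodr_ile1 // => i.
  by move=> /mem_rem/fle1->; rewrite normr_ge0.
by rewrite mul1r.
Qed.

(** * The sign multiplying [Omega2] and the final case analysis *)

Lemma exprN1z_abs (R : unitRingType) (z : int) : (-1) ^ z = (-1) ^+ absz z :> R.
Proof. by case: z => n //; rewrite -[LHS]/(_ ^- n.+1) -exprVn invrN1. Qed.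

Lemma intr_exprN1z (R : unitRingType) (z : int) :
  ((-1 : int) ^ z)%:~R = (-1) ^ z :> R.
Proof. by rewrite !exprN1z_abs rmorphXn rmorphN1. Qed.

(** The product of [epsilonD] with the Legendre symbol in [varpi], as an integer. As
    [(2 / D) ^ 2 = 1], the power of 2 in that symbol matters only through the parity of its
    exponent: [Y] for even lambda, [X] for odd. *)
Definition varpi_sign (E : cm_curve) (r : int) : int :=
  let s := (-1) ^+ ((cm_g1 E).-1)./2 in
  let X := legendre ((cm_g1 E)%:Z * r) (cmD E) in
  let Y := legendre (2 * (cm_g1 E)%:Z * r) (cmD E) in
  if (r == 2 %[mod 4])%Z then if (2 %| cm_lambda E)%N then s * Y else 0
  else if (4 %| r)%Z then
    if (2 %| cm_lambda E)%N then (-1) ^+ (cm_delta E + cm_mu E) * Y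
    else (-1) ^ ((cm_delta E)%:Z + (cm_mu E)%:Z + (r %/ 4)%Z) * X
  else if (2 %| cm_lambda E)%N && (2 %| cm_delta E + cm_mu E + ((cm_g1 E).-1)./2)%N
  then s * Y else 0.

Lemma legendre_exp2M (D k : nat) (a : int) : prime D -> odd D ->
  legendre (2 ^+ k.+1 * a) D = legendre (if (2 %| k)%N then 2 * a else a) D.
Proof.
move=> pD oD.
have l2 : legendre 2 D ^+ 2 = 1.
  case: legendreP => //; rewrite dvdzE /= dvdn_prime2 // => /eqP D2.
  by rewrite D2 in oD.
have lX n : legendre (2 ^+ n) D = legendre 2 D ^+ n.
  by elim: n => [|n IH]; rewrite ?expr0 ?legendre1 // !exprS legendreM // IH.
rewrite legendreM // lX -(odd_double_half k) dvdn2 oddD odd_double addbF oddb.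
case: (odd k) => /=.
  by rewrite -doubleS -muln2 mulnC exprM l2 expr1n mul1r.
by rewrite add0n exprS -muln2 mulnC exprM l2 expr1n mulr1 legendreM.
Qed.

Lemma varpi_signE (R : realType) (E : cm_curve) (r : int) :
  prime (cmD E) -> odd (cmD E) ->
  epsilonD R E r
    * (legendre (2 ^+ (cm_lambda E).+1 * (cm_g1 E)%:Z * r) (cmD E))%:~R
  = (varpi_sign E r)%:~R.
Proof.
move=> pD oD; rewrite -mulrA legendre_exp2M // /varpi_sign -[2 * _ * r]mulrA /epsilonD.
set k := cm_lambda E; set d := cm_delta E; set m := cm_mu E; set h := _./2.
rewrite -(signr_odd _ k) dvdn2.
case: ifP => _.
  case: (odd k) => /=; first by rewrite subrr mulr0 mul0r.
  by rewrite intrM rmorphXn rmorphN1 expr0; field.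
case: ifP => r4.
  (* For [r = 4 q] the last exponent is [lambda * q], so its sign is [(-1) ^ q] for odd lambda and 1
     for even lambda. *)
  have -> : (-1) ^ (d%:Z + m%:Z + ((k%:Z * r) %/ 4)%Z)
      = if odd k then (-1) ^ (d%:Z + m%:Z + (r %/ 4)%Z) else (-1) ^+ (d + m) :> R.
    have /dvdzP[q ->] := r4; rewrite mulrA !mulzK // exprzDr ?unitrN1 //.
    rewrite -exprz_exp -(exprnP _ k) -(signr_odd _ k).
    case: (odd k) => /=; first by rewrite expr1 -exprzDr ?unitrN1.
    by rewrite expr0 exp1rz mulr1.
  case: (odd k) => /=; first by rewrite intrM intr_exprN1z.
  by rewrite intrM rmorphXn rmorphN1.
(* For odd [r], the sum of two signs in [epsilonD] survives exactly when they agree, that is, when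
   the exponents have the same parity. *)
have -> : (2 %| d + m + h)%N = (odd (d + m) == odd h).
  by rewrite dvdn2 oddD; case: odd; case: odd.
rewrite -(signr_odd R h) -(signr_odd int h) -(signr_odd R (d + m)).
case: (odd k) => /=; first by rewrite subrr mulr0 !mul0r.
by case: (odd h); case: (odd (d + m)) => /=;
  rewrite ?intrM ?expr0 ?expr1 ?rmorphN1 ?mulr1z ?mulr0z; field.
Qed.

Lemma omega_spec_eq0 (R : realType) (w : R) (b c : bool) (u : int) :
  [\/ u = 0, u = 1 | u = -1] -> omega_spec w b c ->
  1 + u%:~R * w = 0 <-> b /\ u = -1 \/ c /\ u = 1.
Proof.
move=> uP; case=> [||{}w w1]; case: uP => ->;
  rewrite ?mulr0z ?mulr1z ?mulrN1z ?mul1r ?mulN1r ?mul0r.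
- by split=> [h|[[? /eqP]|[? /eqP]]] //; exfalso; lra.
- by split=> [h|[[? /eqP]|[? /eqP]]] //; exfalso; lra.
- by rewrite subrr; split=> // _; left.
- by split=> [h|[[? /eqP]|[? /eqP]]] //; exfalso; lra.
- by rewrite subrr; split=> // _; right.
- by split=> [h|[[? /eqP]|[? /eqP]]] //; exfalso; lra.
all: move: w1; rewrite ltr_norml => /andP[wl wu].
all: by split=> [h|[[? /eqP]|[? /eqP]]] //; exfalso; lra.
Qed.

Lemma varpi_eq0 (R : realType) (D : nat) (r g : int) (E := CMCurve D g) :
  D \in cmDs -> r != 0 -> g != 0 ->
  varpi R E r = 0 <->
  ~~ (2 %| r)%Z /\ D = 7%N \/
  (frakA 2 (cm_g1 E) %| r)%Z /\ varpi_sign E r = -1 \/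
  2%N \in calJ E 3 r /\ D = 11%N /\ varpi_sign E r = 1.
Proof.
move=> hD r0 g0; have [pD D4] := cmDs_prime hD.
have oD : odd D by lia.
have signP : [\/ varpi_sign E r = 0, varpi_sign E r = 1 | varpi_sign E r = -1].
  have sM n a : [\/ (-1) ^+ n * legendre a D = 0, (-1) ^+ n * legendre a D = 1
      | (-1) ^+ n * legendre a D = -1].
    rewrite -signr_odd; case: (odd n); case: legendreP => _;
      rewrite ?expr0 ?expr1 ?mulr0 ?mulr1 ?mulrNN ?mul1r;
      by [constructor 1|constructor 2|constructor 3].
  by rewrite /varpi_sign exprN1z_abs; do !case: ifP => _ //; constructor 1.
have := omega_spec_eq0 signP (omegaP R r hD g0).
rewrite /varpi varpi_signE //= -/E => spec.
split => [/eqP|].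
  rewrite -mulrA mulf_eq0 hDr_eq0 // mulf_eq0 invr_eq0 pnatr_eq0 /=.
  move=> /orP[/andP[r2 /eqP D7]|].
    by left.
  by move=> /eqP/spec[[]|[/andP[? /eqP]]]; right; [left|right].
case=> [[r2 D7]|[[fr u1]|[J [D11 u1]]]].
- have /eqP -> : hDr R D r == 0 by rewrite hDr_eq0 // r2 D7 eqxx.
  by rewrite !mul0r.
- by rewrite (spec.2 _) ?mulr0 //; left.
- by rewrite (spec.2 _) ?mulr0 //; right; rewrite J D11 eqxx.
Qed.

Lemma signM_eq (x y : int) : `|x| = 1 ->
  (x * y = -1 <-> x = - y) /\ (x * y = 1 <-> x = y).
Proof. by move=> x1; have /orP[/eqP->|/eqP->] : (x == 1) || (x == -1); [lia|lia|lia]. Qed.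

Lemma mod4_cases (r : int) :
  [\/ [/\ (r = 2 %[mod 4])%Z, ~ (r = 0 %[mod 4])%Z & (2 %| r)%Z],
      [/\ ~ (r = 2 %[mod 4])%Z, (r = 0 %[mod 4])%Z & (2 %| r)%Z] |
      [/\ ~ (r = 2 %[mod 4])%Z, ~ (r = 0 %[mod 4])%Z & ~~ (2 %| r)%Z]].
Proof.
have : (r %% 4)%Z = 0 \/ (r %% 4)%Z = 1 \/ (r %% 4)%Z = 2 \/ (r %% 4)%Z = 3 by lia.
by move=> [|[|[|]]] h; [constructor 2|constructor 3|constructor 1|constructor 3];
  split; lia.
Qed.

Lemma and4E (P Q S T : Prop) : [/\ P, Q, S & T] = (P /\ Q /\ S /\ T).
Proof. by apply/propext; split=> [[]|[? [? []]]]. Qed.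

Lemma and5E (P Q S T U : Prop) : [/\ P, Q, S, T & U] = (P /\ Q /\ S /\ T /\ U).
Proof. by apply/propext; split=> [[]|[? [? [? []]]]]. Qed.

(** As [s], [w], [v] are signs, [u = -1] and [u = 1] become equations between a sign and a symbol;
    the rest is propositional once [r] modulo 4 and the parities are fixed. *)
Lemma vanishing_cases (r s w v X Y : int) (l par A J : bool) (D11 D7 : Prop) :
  `|s| = 1 -> `|w| = 1 -> `|v| = 1 ->
  let u := if (r == 2 %[mod 4])%Z then if l then s * Y else 0
           else if (4 %| r)%Z then if l then w * Y else v * X
           else if l && par then s * Y else 0 in
  ~~ (2 %| r)%Z /\ D7 \/ A /\ u = -1 \/ J /\ D11 /\ u = 1 <->
  [/\ (r = 2 %[mod 4])%Z, - s = Y, l & A] \/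
  [/\ (r = 0 %[mod 4])%Z, w = - Y, l & A] \/
  [/\ (r = 0 %[mod 4])%Z, v = - X, ~~ l & A] \/
  [/\ ~~ (2 %| r)%Z, - s = Y, l, par & A] \/
  [/\ (r = 2 %[mod 4])%Z, s = Y, l, J & D11] \/
  [/\ (r = 0 %[mod 4])%Z, w = Y, l, J & D11] \/
  [/\ (r = 0 %[mod 4])%Z, v = X, ~~ l, J & D11] \/
  [/\ ~~ (2 %| r)%Z, s = Y, l && par, J & D11] \/
  (~~ (2 %| r)%Z /\ D7).
Proof.
move=> /(signM_eq Y)[sY1 sY2] /(signM_eq Y)[wY1 wY2] /(signM_eq X)[vX1 vX2].
have sN : - s = Y <-> s = - Y by split=> [<-|->]; rewrite opprK.
have z1 : (0 : int) <> -1 by [].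
have z2 : (0 : int) <> 1 by [].
have -> : (4 %| r)%Z = (r == 0 %[mod 4])%Z by rewrite eqz_mod_dvd subr0.
rewrite !and4E !and5E.
have := mod4_cases r.
move: (r %% 4)%Z (0 %% 4)%Z (2 %% 4)%Z (2 %| r)%Z => r4 r0 r2 d2 r_cases /=.
(* [tauto] takes coerced booleans as atoms, so the truth values of the constants are supplied. *)
have [ff tt] : ~ false /\ true by [].
case: r_cases => [[p2 n0 ->]|[n2 p0 ->]|[n2 n0 /negPf->]] /=.
- by rewrite (introT eqP p2); case: l => /=; tauto.
- by rewrite (introF eqP n2) (introT eqP p0); case: l => /=; tauto.
- by rewrite (introF eqP n2) (introF eqP n0); case: l; case: par => /=; tauto.
Qed.

Theorem theorem7p5 (R : realType) (D : nat) (r g : int) :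
  D \in [:: 7; 11; 19; 43; 67; 163]%N -> r != 0 -> ~~ (D %| r)%Z -> g != 0 ->
  let E := CMCurve D g in
  let delta := cm_delta E in
  let lambda := cm_lambda E in
  let mu := cm_mu E in
  let g1 := cm_g1 E in
  varpi R E r = 0 <->
  [/\ (r = 2 %[mod 4])%Z, (-1) ^+ (g1.+1)./2 = legendre (2 * g1%:Z * r) D,
      (2 %| lambda)%N & (frakA 2 g1 %| r)%Z] \/
  [/\ (r = 0 %[mod 4])%Z,
      (-1) ^+ (delta + mu) = - legendre (2 * g1%:Z * r) D,
      (2 %| lambda)%N & (frakA 2 g1 %| r)%Z] \/
  [/\ (r = 0 %[mod 4])%Z,
      (-1) ^ (delta%:Z + mu%:Z + (r %/ 4)%Z) = - legendre (g1%:Z * r) D,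
      ~~ (2 %| lambda)%N & (frakA 2 g1 %| r)%Z] \/
  [/\ ~~ (2 %| r)%Z, (-1) ^+ (g1.+1)./2 = legendre (2 * g1%:Z * r) D,
      (2 %| lambda)%N, (2 %| delta + mu + (g1.-1)./2)%N
    & (frakA 2 g1 %| r)%Z] \/
  [/\ (r = 2 %[mod 4])%Z, (-1) ^+ (g1.-1)./2 = legendre (2 * g1%:Z * r) D,
      (2 %| lambda)%N, 2%N \in calJ E 3 r & D = 11%N] \/
  [/\ (r = 0 %[mod 4])%Z,
      (-1) ^+ (delta + mu) = legendre (2 * g1%:Z * r) D,
      (2 %| lambda)%N, 2%N \in calJ E 3 r & D = 11%N] \/
  [/\ (r = 0 %[mod 4])%Z,
      (-1) ^ (delta%:Z + mu%:Z + (r %/ 4)%Z) = legendre (g1%:Z * r) D,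
      ~~ (2 %| lambda)%N, 2%N \in calJ E 3 r & D = 11%N] \/
  [/\ ~~ (2 %| r)%Z, (-1) ^+ (g1.-1)./2 = legendre (2 * g1%:Z * r) D,
      (2 %| lambda)%N && (2 %| delta + mu + (g1.-1)./2)%N,
      2%N \in calJ E 3 r & D = 11%N] \/
  (~~ (2 %| r)%Z /\ D = 7%N).
Proof.
move=> hD r0 _ g0 E delta lambda mu g1.
have og : odd g1.
  have [_ _] := cm_decomposition hD g0.
  by rewrite coprimeMr coprimen2 => /andP[].
apply: iff_trans (varpi_eq0 R hD r0 g0) _.
(* Since [g1] is odd, the two exponents differ by exactly 1. *)
have -> : (-1) ^+ (g1.+1)./2 = - (-1) ^+ (g1.-1)./2 :> int.
  by rewrite -[RHS]mulN1r -exprS; congr (_ ^+ _); lia.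
rewrite /varpi_sign -/E -/delta -/lambda -/mu -/g1 /=.
have n1 (n : nat) : `|(-1) ^+ n| = 1 :> int by rewrite normrX normrN1 expr1n.
by rewrite exprN1z_abs; apply: vanishing_cases.
Qed.
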